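(* Let $1 < t < k$ and $m \geq 2k-t$ be integers, and let $\mathcal F$ be a $t$-intersecting family of $k$-multisets of $[m]$ such that $\left|\bigcap_{A \in \mathcal F} A\right| < t$. 1. If $m > t(k-t)+2$ and $k \leq 2t+1$, then $|\mathcal F| \leq |\mathcal F_{(1)}|$, with equality if and only if $\mathcal F$ is isomorphic to $\mathcal F_{(1)}$. 2. If $m > t(k-t)+2$ and $k > 2t+1$, then $|\mathcal F| \leq \max\{|\mathcal F_{(1)}|, |\widetilde{\mathcal F}_t|\}$, with equality if and only if $\mathcal F$ is isomorphic to the larger of $\mathcal F_{(1)}$ and $\widetilde{\mathcal F}_t$.
   Context: A $k$-multiset of $[m]=\{1,\dots,m\}$ is a multiset of cardinality $k$ (counting repetitions) with elements from $[m]$. The intersection of multisets has multiplicities equal to the minimum of the multiplicities; sets are multisets with all multiplicities one; sizes count repetitions. A family is $t$-intersecting if $|A\cap B|\ge t$ for all members $A,B$. $\mathcal F_{(1)}=\{G \text{ a } k\text{-multiset of } [m]: |G\cap[t+2]|\ge t+1\}$. $\widetilde{\mathcal F}_t=\{A \text{ a } k\text{-multiset of } [m]: [t]\subseteq A,\ A\cap[t+1,k+1]\ne\emptyset\}\cup\{[k+1]\setminus\{i\}: i=1,\dots,t\}$, where $[x,y]=\{x,\dots,y\}$. Families are isomorphic if one is obtained from the other by a permutation of $[m]$. *)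

(* Defs.v *)
From mathcomp Require Import all_boot fingroup perm finmap multiset.

Set Implicit Arguments.
Unset Strict Implicit.
Unset Printing Implicit Defensive.

Local Open Scope fset_scope.
Local Open Scope mset_scope.
Local Open Scope nat_scope.

(* The ground set [m] = {1, ..., m} is 'I_m: the element x of [m] is the ordinal
   of value x - 1. *)

Definition mset_of_set m (S : {set 'I_m}) : {mset 'I_m} := seq_mset (enum S).

Definition itv m (x y : nat) : {set 'I_m} := [set i : 'I_m | x <= i.+1 <= y].

Definition kmultisets m k : {fset {mset 'I_m}} :=
  [fset seq_mset (tval s) | s in {: k.-tuple 'I_m}].

Lemma in_kmultisets m k (A : {mset 'I_m}) :
  (A \in kmultisets m k) = (size A == k).
Proof.
apply/imfsetP/idP => [[s _ ->]|szA].
  by rewrite (perm_size (perm_eq_seq_mset _)) size_tuple.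
by exists (Tuple szA) => //=; rewrite seq_mset_id.
Qed.

Definition t_intersecting m t (F : {fset {mset 'I_m}}) : Prop :=
  {in F &, forall A B : {mset 'I_m}, t <= size (A `&` B)}.

(* Multisets on 'I_m have no largest element, so the intersection is taken
   inside the union of the members; it is empty when F is empty. *)
Definition mset_bigcap m (F : {fset {mset 'I_m}}) : {mset 'I_m} :=
  \big[msetI/(\big[msetU/mset0]_(A <- F) A)]_(A <- F) A.

Lemma mset_bigcapP m (F : {fset {mset 'I_m}}) (B : {mset 'I_m}) :
  F != fset0 -> reflect {in F, forall A, B `<=` A} (B `<=` mset_bigcap F).
Proof.
case: (fset_0Vmem F) => [->|[A0 A0F] _]; first by rewrite eqxx.
rewrite /mset_bigcap.
have subU (s : seq {mset 'I_m}) A :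
    A \in s -> A `<=` \big[msetU/mset0]_(C <- s) C.
  elim: s => //= C s IHs.
  rewrite in_cons big_cons => /orP[/eqP->|/IHs AU]; first exact: msubsetUl.
  by rewrite (msubset_trans AU) ?msubsetUr.
set U := \big[msetU/mset0]_(A <- F) A.
have cap s : (B `<=` \big[msetI/U]_(A <- s) A) =
             (B `<=` U) && all (msubset B) s.
  elim: s => [|C s IHs]; first by rewrite big_nil andbT.
  by rewrite big_cons msubsetI IHs /= andbCA.
rewrite cap; apply: (iffP andP) => [[_ /allP]|BF] //.
split; last exact/allP.
exact: msubset_trans (BF _ A0F) (subU _ _ A0F).
Qed.

Definition F1 m k t : {fset {mset 'I_m}} :=
  [fset G in kmultisets m k |
     t + 1 <= size (G `&` mset_of_set (itv m 1 (t + 2)))].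

Definition Ftilde m k t : {fset {mset 'I_m}} :=
  ([fset A in kmultisets m k |
      (mset_of_set (itv m 1 t) `<=` A)%mset &&
      ((A `&` mset_of_set (itv m (t + 1) (k + 1)))%mset != mset0)]
   `|` [fset mset_of_set (itv m 1 (k + 1) :\ i) | i in itv m 1 t])%fset.

Definition mset_perm m (s : {perm 'I_m}) (A : {mset 'I_m}) : {mset 'I_m} :=
  seq_mset (map s A).

Definition isomorphic m (F G : {fset {mset 'I_m}}) : Prop :=
  exists s : {perm 'I_m}, G = [fset mset_perm s A | A in F].

(* Main.v *)
(** A family of multisets is studied through the vectors of multiplicities of its members.
    Two kinds of compressions preserve its size and the t-intersection property: swapping
    two multiplicities (p, q) with p > q into (q, p), and balancing them into
    (q + 1, p - 1).  Removing a common element and inducting on t shows that a largest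
    non-trivial family has no element common to all its members; this makes it possible to
    choose the compressions so that the family stays non-trivial.

    A family stable under balancing has t-intersecting supports.  If it is moreover stable
    under swaps, the generating-set method of Ahlswede and Khachatrian applies: look at the
    smallest initial segment [l] that determines the family, push the generators which
    use the point l, and compare sizes.  Either the family grows or it is one of the families
    H(U, L), with |U| = t and t + 2 <= |L| <= k + 1, of the multisets that contain U and
    meet L \ U, or contain L \ y for some y in U.  The case |L| = t + 2 is F_(1), the case
    |L| = k + 1 is the family tilde F_t, and the size of H(U, L) first falls and then rises
    with |L|, so that only these two can be largest.

    For uniqueness the compressions are undone: a t-intersecting family that one step
    compresses onto some H(U, L) is itself of this form. *)

Require Import Defs.
From mathcomp Require Import all_boot fingroup perm finmap multiset.
From mathcomp Require Import zify.

Set Implicit Arguments.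
Unset Strict Implicit.
Unset Printing Implicit Defensive.

Local Open Scope mset_scope.
Local Open Scope fset_scope.
Local Open Scope nat_scope.

(** * Vectors and families *)

(** The obstacle is that a compression may create a common part. In a family without a common
    element, a compression of [(i, j)] that makes it trivial forces the common vector to be j^t, so
    every member contains j^t or i^(t+e), with e = 0 for a swap and e = 1 for a balancing. For t > 1
    this contradicts balance, or another pair can be balanced instead. For t = 1 it is a genuine
    possibility; there, however, overlapping means overlapping supports, so swaps alone suffice, and
    after a relabelling the bad pair becomes the points 0 and 1, which are then never swapped with
    each other. The induction on t compares sizes only, so t = 1 has to deliver no more than a size.
    It lowers k and t together, and k - t being fixed, the bound on m passes down. That bound is
    what makes pushing profitable: in the tightest case the gain reads exactly t(k - t) < m - 2.
    Every compression lowers an energy, so the structure is found by induction on the energy, one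
    compression being undone at each step. *)

Notation vec m := {ffun 'I_m -> nat}.

Definition mu m (a : vec m) (x : 'I_m) : nat := a x.

Lemma vecP m (a b : vec m) : (forall x, mu a x = mu b x) -> a = b.
Proof. by move=> h; apply/ffunP. Qed.

Section Basics.
Variable m : nat.
Implicit Types (a b : vec m) (F G : {fset vec m}) (S U L E : {set 'I_m}) (t k : nat).

Definition wt a := \sum_x mu a x.
(** The size of the multiset intersection. *)
Definition ov a b := \sum_x minn (mu a x) (mu b x).
Definition supp a : {set 'I_m} := [set x | 0 < mu a x].

Definition vectors k : {fset vec m} :=
  [fset a in [fset [ffun x => nat_of_ord ((g : {ffun 'I_m -> 'I_k.+1}) x)]
                | g in {: {ffun 'I_m -> 'I_k.+1}}]
     | wt a == k].

Lemma in_supp a x : (x \in supp a) = (0 < mu a x).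
Proof. by rewrite inE. Qed.

Lemma leq_wt a x : mu a x <= wt a.
Proof. by rewrite /wt (bigD1 x) //= leq_addr. Qed.

Lemma in_vectors k a : (a \in vectors k) = (wt a == k).
Proof.
rewrite !inE /=; case: eqP => [wa|]; last by rewrite andbF.
rewrite andbT; apply/imfsetP.
exists [ffun x => inord (mu a x)] => //=; apply/ffunP => x.
by rewrite !ffunE inordK // ltnS -wa leq_wt.
Qed.

Lemma ovC a b : ov a b = ov b a.
Proof. by apply: eq_bigr => x _; rewrite minnC. Qed.

Lemma ov_self a : ov a a = wt a.
Proof. by apply: eq_bigr => x _; rewrite minnn. Qed.

Lemma card_supp_le a : #|supp a| <= wt a.
Proof.
rewrite -sum1_card /wt big_mkcond /=; apply: leq_sum => x _.
by rewrite in_supp; case: ifP.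
Qed.

Lemma card_suppI_le a b : #|supp a :&: supp b| <= ov a b.
Proof.
rewrite -sum1_card /ov big_mkcond /=; apply: leq_sum => x _.
by rewrite in_setI !in_supp; case: ifP => // /andP[]; lia.
Qed.

Lemma ov_gt0 a b : (0 < ov a b) = (supp a :&: supp b != set0).
Proof.
rewrite lt0n sum_nat_eq0 negb_forall; apply/existsP/set0Pn => -[x].
  by move=> h; exists x; rewrite in_setI !in_supp; lia.
by rewrite in_setI !in_supp => h; exists x; lia.
Qed.

Definition common (T : vec m) F := all (fun a => [forall x, mu T x <= mu a x]) F.

(** A common part of size at least [t] lies above a vector of weight exactly [t], so non-triviality
    becomes a decidable statement about finitely many vectors. *)
Definition ntriv t F : bool := all (fun T => ~~ common T F) (vectors t).

Lemma commonP (T : vec m) F : reflect {in F, forall a x, mu T x <= mu a x} (common T F).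
Proof. by apply: (iffP allP) => h a aF; apply/forallP; apply: h. Qed.

Lemma ntrivP t F : reflect (forall T, wt T = t -> ~ {in F, forall a x, mu T x <= mu a x})
  (ntriv t F).
Proof.
apply: (iffP allP) => [h T wT /commonP cT|h T].
  by have := h T; rewrite in_vectors wT eqxx cT => /(_ isT).
by rewrite in_vectors => /eqP wT; apply/commonP; apply: h.
Qed.

Lemma ntrivW t F G : F `<=` G -> ntriv t F -> ntriv t G.
Proof.
move=> /fsubsetP FG /ntrivP h; apply/ntrivP => T wT c; apply: (h T wT) => a aF.
exact/c/FG.
Qed.

Definition fam k t F : bool :=
  [&& all (fun a => wt a == k) F, all (fun a => all (fun b => t <= ov a b) F) F
    & ntriv t F].

Lemma famP k t F : reflect
  [/\ {in F, forall a, wt a = k}, {in F &, forall a b, t <= ov a b} & ntriv t F]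
  (fam k t F).
Proof.
apply: (iffP and3P) => -[h1 h2 h3]; split=> //.
- by move=> a aF; apply/eqP; move/allP: h1; apply.
- by move=> a b aF bF; move/allP: h2 => /(_ _ aF) /allP /(_ _ bF).
- by apply/allP => a aF; apply/eqP/h1.
- by apply/allP => a aF; apply/allP => b bF; apply: h2.
Qed.

Definition maxfam k t F := fam k t F /\ forall G, fam k t G -> #|` G| <= #|` F|.

Lemma exists_maxfam k t F : fam k t F -> exists G, maxfam k t G.
Proof.
move=> fF.
pose P n := has (fun G => fam k t G && (#|` G| == n)) (fpowerset (vectors k)).
have Pow G : fam k t G -> G \in fpowerset (vectors k).
  by move=> /famP[h _ _]; rewrite fpowersetE; apply/fsubsetP => a /h wa; rewrite in_vectors wa.
have exP : exists n, P n.
  by exists #|` F|; apply/hasP; exists F; rewrite ?Pow // fF eqxx.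
have ubP n : P n -> n <= #|` vectors k|.
  case/hasP=> G; rewrite fpowersetE => sG /andP[_ /eqP <-].
  exact: fsubset_leq_card.
case: (ex_maxnP exP ubP) => n /hasP[G _ /andP[fG /eqP cG]] mx.
exists G; split=> // G' fG'; rewrite cG; apply: mx.
by apply/hasP; exists G'; rewrite ?Pow // fG' eqxx.
Qed.

(** Since [b] overlaps itself in [k >= t], adding it would give a larger admissible family. *)
Lemma maxfam_closed k t F b : maxfam k t F -> t <= k -> wt b = k ->
  {in F, forall a, t <= ov b a} -> b \in F.
Proof.
move=> [/famP[wF oF nF] mF] tk wb ob; apply: contraT => bF.
have /mF : fam k t (b |` F).
  apply/famP; split.
  - by move=> a /fset1UP[->|/wF].
  - move=> a c /fset1UP[->|aF] /fset1UP[->|cF].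
    + by rewrite ov_self wb.
    + exact: ob.
    + by rewrite ovC; apply: ob.
    + exact: oF.
  - exact: ntrivW (fsubsetU1 _ _) nF.
by rewrite cardfsU1 bF ltnn.
Qed.

Lemma maxfam_eq k t F G : maxfam k t F -> fam k t G -> F `<=` G -> F = G.
Proof.
by move=> [_ mF] fG FG; apply/eqP; rewrite eqEfcard FG mF.
Qed.

(* With #|U| = t, [hfam k U L] is F_(1) when #|L| = t + 2 and the family
   tilde F_t when #|L| = k + 1, up to a permutation of the ground set. *)
Definition hset U L S : bool :=
  (U \subset S) && (S :&: (L :\: U) != set0) || [exists y in U, L :\ y \subset S].

Definition hfam k U L : {fset vec m} := [fset a in vectors k | hset U L (supp a)].

Lemma in_hfam k U L a : (a \in hfam k U L) = (wt a == k) && hset U L (supp a).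
Proof. by rewrite 2!inE /= in_vectors. Qed.

(** A test vector: for [x] in [E] its support is [E], and all surplus multiplicity sits at [x].
    Against a vector vanishing at [x] it behaves like the plain set [E]. *)
Definition padded k E (x : 'I_m) : vec m :=
  [ffun y => (y \in E) + (y == x) * (k - #|E|)].

Lemma wt_padded k E x : #|E| <= k -> wt (padded k E x) = k.
Proof.
move=> Ek; rewrite /wt.
under eq_bigr => y _ do rewrite /mu ffunE.
have sE : \sum_x0 nat_of_bool (x0 \in E) = #|E|.
  by rewrite -sum1_card [RHS]big_mkcond; apply: eq_bigr => y _; case: (y \in E).
rewrite big_split /= sE (bigD1 x) //= eqxx mul1n big1 ?addn0 ?subnKC // => y nyx.
by rewrite (negPf nyx) mul0n.
Qed.

Lemma supp_padded k E x : x \in E -> supp (padded k E x) = E.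
Proof.
move=> xE; apply/setP => y; rewrite in_supp /mu ffunE.
case: (boolP (y \in E)) => // yE; case: eqP => // yx.
by rewrite yx xE in yE.
Qed.

Lemma ov_padded k E x a : mu a x = 0 -> ov a (padded k E x) = #|supp a :&: E|.
Proof.
move=> ax; rewrite -sum1_card [RHS]big_mkcond; apply: eq_bigr => y _.
rewrite [mu (padded _ _ _) _]ffunE in_setI in_supp.
have [->|_] := eqVneq y x; first by rewrite ax min0n.
by rewrite mul0n addn0; case: (y \in E); rewrite ?andbT ?andbF ?minn0 //; case: (mu a y).
Qed.

End Basics.

(** * Compressions *)

Section Shift.
Variable m : nat.
Implicit Types (a b : vec m) (F G : {fset vec m}) (S U L E : {set 'I_m}) (t k e : nat).
Implicit Types (i j : 'I_m).

(* [e = 0] swaps two multiplicities and [e = 1] balances them; where it is defined,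
   the reflection is an isometry for [ov]. *)
Definition shiftable i j e a := mu a j + e < mu a i.

Definition reflect_vec i j e a : vec m :=
  [ffun x => if x == i then mu a j + e else if x == j then mu a i - e else mu a x].

Definition shift1 i j e F a :=
  if shiftable i j e a && (reflect_vec i j e a \notin F) then reflect_vec i j e a else a.

Definition shift i j e F : {fset vec m} := [fset shift1 i j e F a | a in F].

Lemma sum_pair i j (f : 'I_m -> nat) : i != j ->
  \sum_x f x = f i + f j + \sum_(x | (x != i) && (x != j)) f x.
Proof.
by move=> ij; rewrite (bigD1 i) //= (bigD1 j) 1?eq_sym //= addnA.
Qed.

Lemma eq_sum_pair i j (f g : 'I_m -> nat) :
  (forall x, x != i -> x != j -> f x = g x) ->
  \sum_(x | (x != i) && (x != j)) f x = \sum_(x | (x != i) && (x != j)) g x.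
Proof. by move=> fg; apply: eq_bigr => x /andP[]; apply: fg. Qed.

Section Pair.
Variables (i j : 'I_m) (e : nat).
Hypothesis ij : i != j.
Local Notation rho := (reflect_vec i j e).
Local Notation dom := (shiftable i j e).

Lemma reflect_i a : mu (rho a) i = mu a j + e.
Proof. by rewrite /mu ffunE eqxx. Qed.

Lemma reflect_j a : mu (rho a) j = mu a i - e.
Proof. by rewrite /mu ffunE eq_sym (negPf ij) eqxx. Qed.

Lemma reflect_x a x : x != i -> x != j -> mu (rho a) x = mu a x.
Proof. by move=> /negPf xi /negPf xj; rewrite /mu ffunE xi xj. Qed.

Lemma reflectK a : e <= mu a i -> rho (rho a) = a.
Proof.
move=> ei; apply: vecP => x.
have [->|xi] := eqVneq x i; first by rewrite reflect_i reflect_j subnK.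
have [->|xj] := eqVneq x j; first by rewrite reflect_j reflect_i addnK.
by rewrite !reflect_x.
Qed.

Lemma shiftable_le a : dom a -> e <= mu a i.
Proof. by rewrite /shiftable; lia. Qed.

Lemma reflect_not_shiftable a : e <= mu a i -> dom (rho a) -> ~~ dom a.
Proof. by rewrite /shiftable reflect_i reflect_j; lia. Qed.

Lemma reflect_inj a b : dom a -> dom b -> rho a = rho b -> a = b.
Proof.
by move=> /shiftable_le da /shiftable_le db eab; rewrite -(reflectK da) eab reflectK.
Qed.

Lemma wt_reflect a : dom a -> wt (rho a) = wt a.
Proof.
move=> da; rewrite /wt !(sum_pair _ ij) reflect_i reflect_j.
rewrite (eq_sum_pair (g := mu a)) => [|x xi xj]; last exact: reflect_x.
by move: da; rewrite /shiftable; lia.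
Qed.

Lemma ov_pair a b : ov a b = minn (mu a i) (mu b i) + minn (mu a j) (mu b j)
  + \sum_(x | (x != i) && (x != j)) minn (mu a x) (mu b x).
Proof. exact: sum_pair. Qed.

Lemma ov_reflect2 a b : dom a -> dom b -> ov (rho a) (rho b) = ov a b.
Proof.
move=> da db; rewrite !ov_pair !reflect_i !reflect_j; congr addn.
  by move: da db; rewrite /shiftable; lia.
by apply: eq_sum_pair => x xi xj; rewrite !reflect_x.
Qed.

Lemma ov_reflect_r a b : dom a -> dom b -> ov (rho a) b = ov a (rho b).
Proof.
move=> da db; rewrite !ov_pair !reflect_i !reflect_j; congr addn.
  by move: da db; rewrite /shiftable; lia.
by apply: eq_sum_pair => x xi xj; rewrite !reflect_x.
Qed.

(** The vector [b] lies on the far side of the mirror, or on it, and reflecting [a] brings it to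
    that side. *)
Lemma ov_reflect_ge a b : dom a -> ~~ dom b -> ov a b <= ov (rho a) b.
Proof.
move=> da db; rewrite !ov_pair !reflect_i !reflect_j; apply: leq_add.
  by move: da db; rewrite /shiftable; lia.
by rewrite (eq_sum_pair (g := fun x => minn (mu (rho a) x) (mu b x))) => // x xi xj; rewrite reflect_x.
Qed.

Variable F : {fset vec m}.
Local Notation s1 := (shift1 i j e F).

Lemma shift1P a : (dom a /\ rho a \notin F /\ s1 a = rho a) \/
  (s1 a = a /\ (dom a -> rho a \in F)).
Proof.
rewrite /shift1; case: (boolP (dom a)) => da; last by right.
by case: (boolP (rho a \in F)) => raF; [right | left].
Qed.

Lemma shift1_inj : {in F &, injective s1}.
Proof.
move=> a b aF bF.
case: (shift1P a) => [[da [ra ->]]|[-> ha]]; case: (shift1P b) => [[db [rb ->]]|[-> hb]] //.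
- exact: reflect_inj.
- by move=> eb; rewrite eb bF in ra.
- by move=> eb; rewrite -eb aF in rb.
Qed.

Lemma card_shift : #|` shift i j e F| = #|` F|.
Proof. by rewrite /shift card_in_imfset //; apply: shift1_inj. Qed.

Lemma wt_shift1 a : wt (s1 a) = wt a.
Proof. by case: (shift1P a) => [[da [_ ->]]|[->]] //; apply: wt_reflect. Qed.

Lemma in_shift1 a : a \in F -> s1 a \in shift i j e F.
Proof. by move=> aF; apply/imfsetP; exists a. Qed.

Lemma shift_ov t : {in F &, forall a b, t <= ov a b} ->
  {in shift i j e F &, forall a b, t <= ov a b}.
Proof.
move=> oF _ _ /imfsetP[a /= aF ->] /imfsetP[b /= bF ->].
(* Here [c] moves and [d] stays. If [d] stayed because its reflection was present, the reflection is
   passed to the other argument; otherwise [d] is on the far side and the overlap can only grow. *)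
have mixed c d : c \in F -> d \in F -> dom c -> (dom d -> rho d \in F) -> t <= ov (rho c) d.
  move=> cF dF dc hd; case: (boolP (dom d)) => dd.
    by rewrite ov_reflect_r // oF // hd.
  by apply: leq_trans (ov_reflect_ge dc dd); apply: oF.
case: (shift1P a) => [[da [ra ->]]|[-> ha]]; case: (shift1P b) => [[db [rb ->]]|[-> hb]].
- by rewrite ov_reflect2 // oF.
- exact: mixed.
- by rewrite ovC; apply: mixed.
- exact: oF.
Qed.

Lemma shift_fam k t : fam k t F -> ntriv t (shift i j e F) -> fam k t (shift i j e F).
Proof.
move=> /famP[wF oF _] nF; apply/famP; split=> //; last exact: shift_ov.
by move=> _ /imfsetP[a /= aF ->]; rewrite wt_shift1 wF.
Qed.

Lemma shift_maxfam k t : maxfam k t F -> ntriv t (shift i j e F) ->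
  maxfam k t (shift i j e F).
Proof. by move=> [fF mF] nF; split; [apply: shift_fam | rewrite card_shift]. Qed.

Lemma shift_fixed a : shift i j e F = F -> a \in F -> dom a -> rho a \in F.
Proof.
move=> sF aF da; case: (shift1P a) => [[_ [ra sa]]|[_]]; last by apply.
by rewrite -sa -{2}sF in_shift1.
Qed.

Lemma shift_mem_notin a : a \in F -> a \notin shift i j e F ->
  [/\ dom a, rho a \notin F & rho a \in shift i j e F].
Proof.
move=> aF aS; case: (shift1P a) => [[da [ra sa]]|[sa _]].
  by split=> //; rewrite -sa in_shift1.
by move: aS; rewrite -sa in_shift1.
Qed.

Lemma shift_notin_mem b : b \in shift i j e F -> b \notin F ->
  exists a, [/\ a \in F, dom a, b = rho a & a \notin shift i j e F].
Proof.
move=> /imfsetP[a /= aF ->] bF.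
case: (shift1P a) => [[da [ra sa]]|[sa _]]; last by rewrite sa aF in bF.
exists a; split=> //; apply/negP => /imfsetP[c /= cF].
case: (shift1P c) => [[dc [rc ->]] ac|[-> hc] ac].
  by have := reflect_not_shiftable (shiftable_le dc); rewrite -ac dc => /(_ da).
by rewrite ac hc // -ac in ra.
Qed.

(** A vector that has just moved is on the far side of the mirror, so one that is still shiftable
    was blocked by its own reflection. *)
Lemma shift_shiftable_mem a : a \in shift i j e F -> dom a ->
  a \in F /\ rho a \in shift i j e F.
Proof.
move=> /imfsetP[c /= cF ->].
case: (shift1P c) => [[dc [rc ->]] drc|[sc hc] dc].
  by have := reflect_not_shiftable (shiftable_le dc) drc; rewrite dc.
rewrite sc in dc *; split=> //.
have [] := shift1P (rho c) => [[drc _]|[<- _]]; last exact/in_shift1/hc.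
by have := reflect_not_shiftable (shiftable_le dc) drc; rewrite dc.
Qed.

End Pair.

(* Balancing decreases the sum of squares; a swap towards a smaller index keeps it and
   decreases the linear term. *)
Definition weight_energy a := \sum_x (m * mu a x ^ 2 + x * mu a x).
Definition energy F := \sum_(a <- F) weight_energy a.

Lemma energy_reflect i j e a : i != j -> shiftable i j e a -> (e = 0 -> j < i) -> e <= 1 ->
  weight_energy (reflect_vec i j e a) < weight_energy a.
Proof.
move=> ij da ei e1; rewrite /weight_energy !(sum_pair _ ij).
rewrite reflect_i reflect_j // -!addnA.
rewrite (eq_sum_pair (g := fun x => m * mu a x ^ 2 + x * mu a x)) => [|x xi xj]; last first.
  by rewrite reflect_x.
rewrite !addnA ltn_add2r; move: da (ltn_ord j) (ltn_ord i); rewrite /shiftable.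
move: (mu a i) (mu a j) => p q; case: e ei e1 => [|[|//]] ei _ da jm im.
  have {}ei := ei erefl; rewrite addn0 subn0 -!mulnn; nia.
(* Balancing lowers the sum of squares by [2 * (d + 1)] and raises the linear term by less than
   [m * (d + 1)]; hence the factor [m] in the energy. *)
have [d pd] : exists d, p = q + 2 + d by exists (p - (q + 2)); lia.
rewrite pd -!mulnn (_ : q + 2 + d - 1 = q + 1 + d); last by lia.
nia.
Qed.

Lemma energy_shift i j e F : i != j -> (e = 0 -> j < i) -> e <= 1 ->
  shift i j e F != F -> energy (shift i j e F) < energy F.
Proof.
move=> ij ei e1 sF.
have le1 a : weight_energy (shift1 i j e F a) <= weight_energy a.
  case: (shift1P i j e F a) => [[da [_ ->]]|[->]] //.
  exact: ltnW (energy_reflect ij da ei e1).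
have /fsubsetPn[a aF aS] : ~~ (F `<=` shift i j e F).
  by apply: contra sF => FS; rewrite eq_sym eqEfcard FS card_shift /=.
have [da ra _] := shift_mem_notin aF aS.
rewrite /energy big_imfset /=; last exact: (shift1_inj ij).
rewrite (big_fsetD1 a) //= [X in _ < X](big_fsetD1 a) //= -addSn leq_add //.
  by rewrite /shift1 da ra; apply: energy_reflect.
by apply: leq_sum => x _; apply: le1.
Qed.

End Shift.

(** * Compressions of non-trivial families *)

Section Trivializing.
Variable m : nat.
Implicit Types (a b : vec m) (F G : {fset vec m}) (S U L E : {set 'I_m}) (t k e : nat).
Implicit Types (i j : 'I_m).

Definition coreless F := forall x, exists2 a : vec m, a \in F & mu a x = 0 .

Lemma ntrivPn t F : ~~ ntriv t F -> exists2 T : vec m, wt T = t & {in F, forall a x, mu T x <= mu a x}.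
Proof.
by case/allPn => T; rewrite in_vectors negbK => /eqP wT /commonP cT; exists T.
Qed.

Lemma coreless_ntriv t F : 0 < t -> coreless F -> ntriv t F.
Proof.
move=> t0 cF; apply/ntrivP => T wT TF.
have : wt T = 0 by apply: big1 => x _; have [a aF ax] := cF x; apply/eqP; rewrite -leqn0 -ax; apply: TF.
by lia.
Qed.

(** Coordinates other than [i] and [j] do not change, and each vanishes on some member, so the
    common vector [T] lives on [i] and [j]. A member vanishing at [i] does not move, so [T] vanishes
    at [i] too and is j^t. A member that stays contains j^t; one that moves had multiplicity at
    least [t + e] at [i]. *)
Lemma shift_trivial k t F i j e : fam k t F -> coreless F -> i != j -> e <= 1 ->
  ~~ ntriv t (shift i j e F) -> {in F, forall b, t <= mu b j \/ t + e <= mu b i}.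
Proof.
move=> /famP[_ _ nF] cF ij e1 /ntrivPn[T wT TS].
have bnd b : b \in F -> (forall x, mu T x <= mu b x) \/
    (shiftable i j e b /\ forall x, mu T x <= mu (reflect_vec i j e b) x).
  move=> bF; case: (shift1P i j e F b) => [[db [_ sb]]|[sb _]].
    by right; split=> // x; rewrite -sb TS // in_shift1.
  by left=> x; rewrite -{1}sb TS // in_shift1.
have Tx x : x != i -> x != j -> mu T x = 0 .
  move=> xi xj; have [b bF bx] := cF x.
  by case: (bnd b bF) => [/(_ x)|[_ /(_ x)]]; rewrite ?reflect_x //; lia.
have [a aF [da ha hj]] : exists2 a : vec m, a \in F &
    [/\ shiftable i j e a, forall x, mu T x <= mu (reflect_vec i j e a) x & mu a j < mu T j].
  have [/allP h|] := boolP (common T F).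
    by case: (ntrivP _ _ nF T wT) => a aF; apply/forallP/h.
  case/allPn => a aF; rewrite negb_forall => /existsP[x]; rewrite -ltnNge => ax.
  exists a => //; case: (bnd a aF) => [/(_ x)|[da ha]]; first by lia.
  split=> //; have := ha i; have := ha j; rewrite reflect_i reflect_j // => hj hi.
  move: ax; have [->|xi] := eqVneq x i; first by move: da; rewrite /shiftable; lia.
  by have [->//|xj] := eqVneq x j; rewrite Tx.
have Tij : mu T i <= mu T j.
  by move: (ha i); rewrite reflect_i; lia.
have Ti : mu T i = 0 .
  have [b bF bi] := cF i; case: (bnd b bF) => [/(_ i)|[db /(_ i)]]; rewrite ?bi; first by lia.
  by rewrite reflect_i; move: db; rewrite /shiftable; lia.
have Tj : mu T j = t .
  rewrite -wT /wt (sum_pair _ ij) Ti (eq_sum_pair (g := fun=> 0)) //.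
  by rewrite sum_nat_const muln0; lia.
move=> b bF; case: (bnd b bF) => [/(_ j)|[db /(_ j)]]; first by lia.
by rewrite reflect_j // Tj; move: db; rewrite /shiftable; lia.
Qed.

Definition balanced F := forall i j, i != j -> shift i j 1 F = F.

Lemma exists_outside S j : #|S|.+1 < m -> exists2 l, l \notin S & l != j.
Proof.
move=> cS; have /subsetPn[l _] : ~~ ([set: 'I_m] \subset j |: S).
  apply/negP => /subset_leq_card; rewrite cardsT card_ord cardsU1; lia.
by rewrite in_setU1 negb_or => /andP[lj lS]; exists l.
Qed.

Lemma card_supp_mult a i : 0 < mu a i -> #|supp a| + mu a i <= (wt a).+1.
Proof.
move=> ai; rewrite /wt (bigD1 i) //= (cardsD1 i) in_supp ai add1n.
rewrite addSn ltnS addnC leq_add2l.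
rewrite -sum1_card big_mkcond [leqRHS]big_mkcond /=; apply: leq_sum => x _.
by rewrite in_setD1 in_supp; case: (x != i) => //=; case: (mu a x).
Qed.

(* If balancing [i, j] makes a coreless [F] trivial, every member contains j^t or i^(t+1).
   Take [a] in [F] with mu a j = 0.  If balancing [i, l] also failed for every [l]
   outside the support of [a], a member avoiding [i] would contain l^t for all these [l]. *)
Lemma exists_nontrivial_balancing k t F i j : fam k t F -> coreless F -> 1 < t ->
  k < m -> k < t * (m - k + t) -> i != j -> shift i j 1 F != F ->
  exists i' j', [/\ i' != j', shift i' j' 1 F != F & ntriv t (shift i' j' 1 F)].
Proof.
move=> fF cF t1 km kt ij sF.
have [nS|/(shift_trivial fF cF ij (leqnn _)) hij] := boolP (ntriv t (shift i j 1 F)).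
  by exists i, j.
have [wF oF _] := famP _ _ _ fF.
have [a aF aj] := cF j; have [b bF bi] := cF i.
have ai : t < mu a i by case: (hij a aF); lia.
have [/existsP[l /and3P[la lj nS]]|] :=
  boolP [exists l, [&& l \notin supp a, l != j & ntriv t (shift i l 1 F)]].
  rewrite in_supp -leqNgt leqn0 in la; have {la} al := eqP la.
  have il : i != l by apply/eqP => il; rewrite il al in ai.
  (* If this balancing fixed the family, the reflection of [a] would be a member with multiplicity 1
     at [i] and 0 at [j], against [hij]. *)
  exists i, l; split=> //; apply/eqP => sl.
  have da : shiftable i l 1 a by rewrite /shiftable al; lia.
  have := hij _ (shift_fixed sl aF da).
  by rewrite reflect_i reflect_x ?aj ?al 1?eq_sym //; lia.
rewrite negb_exists => /forallP h; exfalso.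
have bl l : l \notin supp a -> t <= mu b l.
  move=> la; have [->|lj] := eqVneq l j; first by case: (hij b bF); rewrite ?bi; lia.
  have := h l; rewrite la lj /= => nS.
  have il : i != l.
    by apply: contraNneq la => <-; rewrite in_supp; lia.
  by case: (shift_trivial fF cF il (leqnn _) nS bF); rewrite ?bi; lia.
(* The member [b] carries multiplicity [t] at every point outside the support of [a]. That support
   has at most [k - t] points, as [a] has multiplicity above [t] at [i], so [b] would be too
   heavy. *)
have : t * (m - #|supp a|) <= k.
  rewrite -{1}(card_ord m) -(cardsC (supp a)) addKn mulnC -sum_nat_const.
  rewrite -(wF b bF) /wt big_mkcond /=; apply: leq_sum => l _.
  by rewrite in_setC; case: ifP => // /bl.
have := card_supp_mult (leq_ltn_trans (leq0n t) ai); rewrite wF // => ca ct.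
have : t * (m - k + t) <= t * (m - #|supp a|) by rewrite leq_mul2l; apply/orP; right; lia.
by lia.
Qed.

Lemma balanced_swap_ntriv k t F i j : fam k t F -> coreless F -> 1 < t -> k < m ->
  balanced F -> i != j -> ntriv t (shift i j 0 F).
Proof.
move=> fF cF t1 km bF ij; apply: contraT.
move=> /(shift_trivial fF cF ij (leq0n _)) hij.
have [wF oF _] := famP _ _ _ fF.
have [a aF aj] := cF j.
have ai : t <= mu a i by case: (hij a aF); lia.
have := card_supp_mult (leq_trans (ltnW t1) ai); rewrite wF // => ca.
have [|l la lj] := @exists_outside (supp a) j; first by lia.
rewrite in_supp -leqNgt leqn0 in la; have {la} al := eqP la.
have il : i != l by apply/eqP => il; move: ai; rewrite il al; lia.
have da : shiftable i l 1 a by rewrite /shiftable al; lia.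
have := hij _ (shift_fixed (bF _ _ il) aF da).
by rewrite reflect_i reflect_x ?aj ?al 1?eq_sym //; lia.
Qed.

(* When the supports of [a] and [b] meet in fewer points than [ov a b], some point [y] lies
   outside both of them, and balancing [a] towards [y] decreases [ov a b] only. *)
Lemma balanced_supp k t F : fam k t F -> 2 * k - t <= m -> balanced F ->
  {in F &, forall a b, t <= #|supp a :&: supp b|}.
Proof.
move=> /famP[wF oF _] km bF a b; move: {2}_.+1 (ltnSn (ov a b)) => n.
elim: n a => // n IHn a abn aF bbF.
have [/forallP h|] := boolP [forall x, minn (mu a x) (mu b x) <= 1].
  apply: leq_trans (oF a b aF bbF) _.
  rewrite -sum1_card /ov [leqRHS]big_mkcond; apply: leq_sum => x _.
  by have := h x; rewrite in_setI !in_supp; case: ifP => // /negbT; lia.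
rewrite negb_forall => /existsP[x]; rewrite -ltnNge => xab.
have [y yab] : exists y, y \notin supp a :|: supp b.
  have /subsetPn[y _ yS] : ~~ ([set: 'I_m] \subset supp a :|: supp b); last by exists y.
  apply/negP => /subset_leq_card; rewrite cardsT card_ord => mc.
  (* The maxima of the multiplicities sum to [2 * k - ov a b], hence to at most [2 * k - t <= m];
     the double point [x] makes the union of the supports smaller still. *)
  have : #|supp a :|: supp b| + 1 <= \sum_z maxn (mu a z) (mu b z).
    rewrite (bigD1 x) //= (cardsD1 x) in_setU !in_supp.
    have -> : (0 < mu a x) || (0 < mu b x) by lia.
    have ab2 : 2 <= maxn (mu a x) (mu b x) by lia.
    rewrite addnAC leq_add //=.
    rewrite -sum1_card big_mkcond [leqRHS]big_mkcond /=; apply: leq_sum => z _.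
    by rewrite in_setD1 in_setU !in_supp; case: (z != x) => //=; case: ifP => //; lia.
  have : \sum_z maxn (mu a z) (mu b z) + ov a b = wt a + wt b.
    by rewrite /ov /wt -!big_split; apply: eq_bigr => z _ /=; lia.
  by rewrite !wF //; have := oF a b aF bbF; lia.
move: yab; rewrite in_setU !in_supp negb_or -!leqNgt !leqn0 => /andP[/eqP ay /eqP biy].
have xy : x != y by apply/eqP => xy; move: xab; rewrite xy ay min0n.
have da : shiftable x y 1 a by rewrite /shiftable ay; move: xab; lia.
have a'F := shift_fixed (bF _ _ xy) aF da.
suff -> : supp a :&: supp b = supp (reflect_vec x y 1 a) :&: supp b.
  apply: IHn => //; move: abn; rewrite ltnS; apply: leq_trans; rewrite !(ov_pair xy).
  rewrite reflect_i reflect_j // [X in _ + X](eq_sum_pair (g := fun z => minn (mu a z) (mu b z))).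
    by lia.
  by move=> z zx zy; rewrite reflect_x.
apply/setP => z; rewrite !in_setI !in_supp.
have [->|zx] := eqVneq z x; first by rewrite reflect_i addn1; congr (_ && _); move: xab; lia.
have [->|zy] := eqVneq z y; first by rewrite biy !andbF.
by rewrite reflect_x.
Qed.

End Trivializing.

(** * Counting vectors by trace *)

Section Counting.
Variable m : nat.
Implicit Types (a b : vec m) (F G : {fset vec m}) (S U L E P : {set 'I_m}) (t k q : nat).

Lemma in_vectors_cond k (p : pred (vec m)) a :
  (a \in [fset b in vectors m k | p b]) = (wt a == k) && p a.
Proof. by rewrite 2!inE /= in_vectors. Qed.

Definition add_ind E a : vec m := [ffun x => mu a x + (x \in E)].

Lemma mu_add_ind E a x : mu (add_ind E a) x = mu a x + (x \in E).
Proof. by rewrite [LHS]/mu ffunE. Qed.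

Definition sub_ind E a : vec m := [ffun x => mu a x - (x \in E)].

Lemma mu_sub_ind E a x : mu (sub_ind E a) x = mu a x - (x \in E).
Proof. by rewrite [LHS]/mu ffunE. Qed.

Lemma add_indK E : cancel (add_ind E) (sub_ind E).
Proof. by move=> a; apply: vecP => x; rewrite mu_sub_ind mu_add_ind addnK. Qed.

Lemma sub_indK E a : E \subset supp a -> add_ind E (sub_ind E a) = a.
Proof.
move=> /subsetP Ea; apply: vecP => x; rewrite mu_add_ind mu_sub_ind subnK //.
by case: (boolP (x \in E)) => // /Ea; rewrite in_supp.
Qed.

Lemma sum_ind E : \sum_x nat_of_bool (x \in E) = #|E|.
Proof. by rewrite -sum1_card [RHS]big_mkcond; apply: eq_bigr => y _; case: (y \in E). Qed.

Lemma wt_add_ind E a : wt (add_ind E a) = wt a + #|E|.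
Proof.
rewrite /wt -sum_ind -big_split; apply: eq_bigr => x _; exact: mu_add_ind.
Qed.

Lemma wt_sub_ind E a : E \subset supp a -> wt (sub_ind E a) = wt a - #|E|.
Proof. by move=> /sub_indK {2}<-; rewrite wt_add_ind addnK. Qed.

Lemma supp_add_ind E a : supp (add_ind E a) = supp a :|: E.
Proof.
apply/setP => x; rewrite in_setU !in_supp mu_add_ind.
by case: (x \in E); rewrite ?orbT ?orbF ?addn0 ?addn1.
Qed.

Lemma card_imfset_vec (f : vec m -> vec m) F : injective f -> #|` [fset f a | a in F]| = #|` F|.
Proof. by move=> fi; rewrite card_imfset. Qed.

(** Stars and bars through Pascal's rule: a vector on [P] either avoids a chosen [x], or arises by
    adding one at [x] to a vector of weight one less. For empty [P] the truncated subtraction still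
    gives 1 at [q = 0] and 0 beyond. *)
Lemma card_vectors_in P q :
  #|` [fset a in vectors m q | supp a \subset P]| = 'C(#|P| + q - 1, q).
Proof.
move: {2}#|P| (erefl #|P|) => p; elim: p P q => [|p IHp] P q cP.
  have /eqP P0 : P == set0 by rewrite -cards_eq0 cP.
  case: q => [|q].
    rewrite bin0; apply/eqP/cardfs1P; exists [ffun=> 0]; apply/fsetP => a.
    rewrite in_fset1 in_vectors_cond; apply/andP/eqP => [[/eqP wa _]|->].
      apply: vecP => x; rewrite [RHS]/mu ffunE; have := leq_wt a x; lia.
    split; last by apply/subsetP => x; rewrite in_supp /mu ffunE.
    by rewrite /wt big1 // => x _; rewrite /mu ffunE.
  rewrite P0 cards0 bin_small; last by lia.
  apply/eqP; rewrite cardfs_eq0; apply/eqP/fsetP => a; rewrite in_vectors_cond subset0 in_fset0.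
  apply/negP => /andP[/eqP wa /eqP /setP sa].
  suff : wt a = 0 by rewrite wa.
  by apply: big1 => x _; have := sa x; rewrite in_supp in_set0; lia.
have /card_gt0P[x xP] : 0 < #|P| by rewrite cP.
have cPx : #|P :\ x| = p by have := cardsD1 x P; rewrite xP cP => -[].
elim: q => [|q IHq].
  have -> : [fset a in vectors m 0 | supp a \subset P]
          = [fset a in vectors m 0 | supp a \subset P :\ x].
    apply/fsetP => a; rewrite !in_vectors_cond; apply: andb_id2l => /eqP wa.
    have -> : supp a = set0.
      by apply/setP => y; rewrite in_supp in_set0; have := leq_wt a y; lia.
    by rewrite !sub0set.
  by rewrite IHp // !bin0.
rewrite cP addSn addnS subn1 /= binS.
rewrite (_ : 'C(p + q, q.+1) = #|` [fset a in vectors m q.+1 | supp a \subset P :\ x]|); last first.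
  by rewrite IHp // cPx addnS subn1.
rewrite (_ : 'C(p + q, q) = #|` [fset add_ind [set x] a |
    a in [fset a in vectors m q | supp a \subset P]]|); last first.
  rewrite card_imfset_vec; first by rewrite IHq cP addSn subn1.
  exact: can_inj (add_indK _).
rewrite -cardfsUI [X in _ + X](_ : _ = 0) ?addn0; last first.
  apply/eqP; rewrite cardfs_eq0 -fsubset0; apply/fsubsetP => a.
  rewrite in_fsetI in_vectors_cond => /andP[/andP[_ /subsetP sa] /imfsetP[b /= _ ab]].
  have := sa x; rewrite ab supp_add_ind in_setU in_set1 eqxx orbT => /(_ isT).
  by rewrite in_setD1 eqxx.
congr #|` _|; apply/fsetP => a; rewrite in_fsetU !in_vectors_cond.
apply/andP/orP => [[/eqP wa sa]|[/andP[wa sa]|/imfsetP[b /=]]].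
- case: (boolP (x \in supp a)) => xa.
    right; apply/imfsetP; exists (sub_ind [set x] a) => /=; last first.
      by rewrite sub_indK ?sub1set.
    rewrite in_vectors_cond wt_sub_ind ?sub1set // wa cards1 subn1 eqxx /=.
    apply: subset_trans sa; apply/subsetP => y; rewrite !in_supp mu_sub_ind; lia.
  left; rewrite wa eqxx; apply/subsetP => y ya; rewrite in_setD1 (subsetP sa) // andbT.
  by apply: contraNneq xa => <-.
- by split=> //; apply: subset_trans sa (subD1set _ _).
rewrite in_vectors_cond => /andP[/eqP wb sb] ->.
by rewrite wt_add_ind wb cards1 addn1 eqxx supp_add_ind subUset sb sub1set.
Qed.

(** Removing one copy of [E] leaves an arbitrary vector of weight [k - #|E|] on [m - #|L| + #|E|]
    points. The size of [E] cancels in the upper entry, so traces of different sizes are compared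
    along one row of Pascal's triangle. *)
Lemma card_trace k L E : E \subset L -> #|E| <= k ->
  #|` [fset a in vectors m k | supp a :&: L == E]| = 'C(m - #|L| + k - 1, k - #|E|).
Proof.
move=> EL Ek; transitivity #|` [fset add_ind E a |
    a in [fset a in vectors m (k - #|E|) | supp a \subset E :|: ~: L]]|; last first.
  rewrite card_imfset_vec; last exact: can_inj (add_indK _).
  rewrite card_vectors_in cardsU.
  have -> : E :&: ~: L = set0.
    by apply/eqP; rewrite setI_eq0 disjoints_subset setCK.
  have := cardsC L; rewrite card_ord cards0 => cL; congr 'C(_, _).
  by have := subset_leq_card EL; lia.
congr #|` _|; apply/fsetP => a; rewrite in_vectors_cond.
apply/andP/imfsetP => [[/eqP wa /eqP aL]|[b /=]].
  have Ea : E \subset supp a by rewrite -aL subsetIl.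
  exists (sub_ind E a); last by rewrite sub_indK.
  rewrite in_vectors_cond wt_sub_ind // wa eqxx /=.
  apply/subsetP => x; rewrite in_supp mu_sub_ind in_setU in_setC -aL in_setI in_supp.
  by case: (x \in L) => //=; lia.
rewrite in_vectors_cond => /andP[/eqP wb sb] ->.
rewrite wt_add_ind wb subnK // eqxx supp_add_ind setIUl (setIidPl EL); split=> //.
apply/eqP/setUidPr; apply/subsetP => x; rewrite in_setI => /andP[xb xL].
by have := subsetP sb x xb; rewrite in_setU in_setC xL orbF.
Qed.

Lemma card_traces k L (C : {set {set 'I_m}}) : {in C, forall E, E \subset L} ->
  #|` [fset a in vectors m k | supp a :&: L \in C]|
  = \sum_(E in C) #|` [fset a in vectors m k | supp a :&: L == E]|.
Proof.
move=> CL; rewrite card_fset_sum1 -big_fset_condE /=.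
rewrite (partition_big (fun a => supp a :&: L) (mem C)) //=.
apply: eq_bigr => E EC; rewrite card_fset_sum1 -big_fset_condE /=.
by apply: eq_bigl => a; case: eqP => [->|]; rewrite ?andbF ?andbT.
Qed.

End Counting.

(** * The families H(U, L) *)

Section HiltonMilner.
Variables (m t k : nat) (U L : {set 'I_m}).
Hypotheses (UL : U \subset L) (cU : #|U| = t) (t0 : 0 < t).
Hypotheses (tL : t + 2 <= #|L|) (Lk : #|L| <= k + 1).
Implicit Types (a b : vec m) (S E : {set 'I_m}).

Lemma hsetP S : reflect
  ((U \subset S /\ exists z, [/\ z \in S, z \in L & z \notin U]) \/
   exists2 y, y \in U & L :\ y \subset S)
  (hset U L S).
Proof.
apply: (iffP orP) => -[h|h]; [left|right|left|right].
- move: h => /andP[-> /set0Pn[z]]; rewrite in_setI in_setD => /and3P[zS zU zL].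
  by split=> //; exists z.
- by move/existsP: h => [y /andP[yU yS]]; exists y.
- move: h => [-> [z [zS zL zU]]] /=; apply/set0Pn; exists z.
  by rewrite in_setI in_setD zS zU.
- by case: h => y yU yS; apply/existsP; exists y; rewrite yU.
Qed.

Lemma card_LDU : #|L :\: U| = #|L| - t.
Proof. by rewrite cardsDS // cU. Qed.

Lemma exists_LDU x : exists z, [/\ z \in L, z \notin U & z != x].
Proof.
have /card_gt0P[z] : 0 < #|(L :\: U) :\ x|.
  by have := cardsD1 x (L :\: U); rewrite card_LDU; lia.
by rewrite in_setD1 in_setD => /and3P[zx zU zL]; exists z.
Qed.

Lemma hset_LD1 y : y \in U -> hset U L (L :\ y).
Proof. by move=> yU; apply/hsetP; right; exists y. Qed.

Lemma hset_U1 z : z \in L -> z \notin U -> hset U L (z |: U).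
Proof.
move=> zL zU; apply/hsetP; left; split; first exact: subsetU1.
by exists z; rewrite setU11.
Qed.

Lemma hsetW S E : S \subset E -> hset U L S -> hset U L E.
Proof.
move=> SE /hsetP[[US [z [zS zL zU]]]|[y yU yS]]; apply/hsetP; [left|right].
  by split; [apply: subset_trans SE | exists z; rewrite (subsetP SE)].
by exists y => //; apply: subset_trans SE.
Qed.

Lemma hset_trace S : hset U L (S :&: L) = hset U L S.
Proof.
apply/idP/idP; first by apply: hsetW; apply: subsetIl.
move=> /hsetP[[US [z [zS zL zU]]]|[y yU yS]]; apply/hsetP; [left|right].
  by rewrite subsetI US UL; split=> //; exists z; rewrite in_setI zS.
by exists y => //; rewrite subsetI yS subD1set.
Qed.

Lemma card_LD1 y : y \in U -> #|L :\ y| = #|L| - 1.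
Proof. by move=> /(subsetP UL) yL; have := cardsD1 y L; rewrite yL; lia. Qed.

Lemma card_U1 z : z \notin U -> #|z |: U| = t.+1.
Proof. by move=> zU; rewrite cardsU1 zU cU. Qed.

(** Two sets of the kind [L :\ y] share at least [#|L| - 2 >= t] points; in the mixed case the extra
    point [z] makes up for the missing [y]. *)
Lemma hset_inter S E : hset U L S -> hset U L E -> t <= #|S :&: E|.
Proof.
have mixed S' E' : U \subset S' -> (exists z, [/\ z \in S', z \in L & z \notin U]) ->
    (exists2 y, y \in U & L :\ y \subset E') -> t <= #|S' :&: E'|.
  move=> US [z [zS zL zU]] [y yU yE].
  have : (z |: (U :\ y)) \subset S' :&: E'.
    rewrite subUset sub1set in_setI zS (subsetP yE) ?subsetI; last first.
      by rewrite in_setD1 zL andbT; apply: contraNneq zU => ->.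
    rewrite (subset_trans _ US) ?subD1set //= (subset_trans _ yE) //.
    exact: setSD.
  move/subset_leq_card; apply: leq_trans.
  by rewrite cardsU1 in_setD1 (negPf zU) andbF; have := cardsD1 y U; rewrite yU; lia.
move=> /hsetP[[US hS]|hS] /hsetP[[UE hE]|hE].
- by rewrite -cU subset_leq_card // subsetI US.
- exact: mixed.
- by rewrite setIC; apply: mixed.
case: hS hE => y yU yS [y' yU' yS'].
have : L :\ y :\ y' \subset S :&: E.
  rewrite subsetI (subset_trans _ yS) ?subD1set //= (subset_trans _ yS') //.
  exact/setSD/subD1set.
move/subset_leq_card; apply: leq_trans.
by have := cardsD1 y' (L :\ y); have := card_LD1 yU; lia.
Qed.

Lemma padded_hfam E x : x \in E -> #|E| <= k -> hset U L E -> padded k E x \in hfam k U L.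
Proof. by move=> xE Ek hE; rewrite in_hfam wt_padded // supp_padded // eqxx. Qed.

Lemma hfam_coreless : coreless (hfam k U L).
Proof.
move=> x; have [z [zL zU zx]] := exists_LDU x.
have [xU|xU] := boolP (x \in U).
  have xE : x \notin L :\ x by rewrite in_setD1 eqxx.
  exists (padded k (L :\ x) z); last first.
    by rewrite /mu ffunE (negPf xE) eq_sym (negPf zx).
  apply: padded_hfam; rewrite ?card_LD1 ?hset_LD1 //; last by lia.
  by rewrite in_setD1 zx.
exists (padded k (z |: U) z); last first.
  by rewrite /mu ffunE in_setU1 eq_sym (negPf zx) (negPf xU).
by apply: padded_hfam; rewrite ?setU11 ?card_U1 ?hset_U1 //; lia.
Qed.

Lemma hfam_fam : fam k t (hfam k U L).
Proof.
apply/famP; split.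
- by move=> a; rewrite in_hfam => /andP[/eqP].
- move=> a b; rewrite !in_hfam => /andP[_ ha] /andP[_ hb].
  by apply: leq_trans (card_suppI_le a b); apply: hset_inter.
- exact: coreless_ntriv hfam_coreless.
Qed.

(** From the vectors containing [U] one removes those with trace exactly [U] and adds those with
    trace [L :\ y], [y] in [U]. The additive form avoids a truncated subtraction. *)
Lemma card_hfam : #|` hfam k U L| + 'C(m - #|L| + k - 1, k - t)
  = 'C(m - t + k - 1, k - t) + t * 'C(m - #|L| + k - 1, k + 1 - #|L|).
Proof.
have -> : 'C(m - #|L| + k - 1, k - t) = #|` [fset a in vectors m k | supp a :&: L == U]|.
  by rewrite card_trace // cU //; lia.
have -> : 'C(m - t + k - 1, k - t) = #|` [fset a in vectors m k | supp a :&: U == U]|.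
  by rewrite card_trace // cU //; lia.
pose C := [set L :\ y | y in U].
have cC : #|C| = t.
  rewrite card_in_imset // => y y' yU yU' e; apply/eqP; apply: contraT => yy'.
  have : y \in L :\ y' by rewrite in_setD1 yy' (subsetP UL).
  by rewrite -e in_setD1 eqxx.
have -> : t * 'C(m - #|L| + k - 1, k + 1 - #|L|)
    = #|` [fset a in vectors m k | supp a :&: L \in C]|.
  rewrite card_traces; last by move=> E /imsetP[y _ ->]; apply: subD1set.
  rewrite -cC -sum_nat_const; apply: eq_bigr => E /imsetP[y yU ->].
  rewrite card_trace ?subD1set ?card_LD1 //; last by lia.
  by congr 'C(_, _); lia.
have notU S : S :&: L \in C -> ~~ (U \subset S).
  case/imsetP => y yU SL; apply/negP => US.
  have : y \in S :&: L by rewrite in_setI (subsetP US) // (subsetP UL).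
  by rewrite SL in_setD1 eqxx.
rewrite -[LHS]cardfsUI -[RHS]cardfsUI; congr (_ + _); last first.
  congr #|` _|; apply/fsetP => a; rewrite !in_fsetI in_hfam !in_vectors_cond.
  case: (wt a == k) => //=.
  have -> : (supp a :&: U == U) && (supp a :&: L \in C) = false.
    by apply/negP => /andP[/eqP/setIidPr Ua /notU]; rewrite Ua.
  apply/negP => /andP[h /eqP aU]; move: h; rewrite -hset_trace aU.
  case/hsetP => [[_ [z [zU _]]]|[y yU yS]]; first by rewrite zU.
  have /subset_leq_card := yS; rewrite card_LD1 // cU; lia.
congr #|` _|; apply/fsetP => a; rewrite !in_fsetU in_hfam !in_vectors_cond.
rewrite -!andb_orr; congr (_ && _); apply/orP/orP => -[].
- case/hsetP=> [[US _]|[y yU yS]]; first by left; apply/eqP/setIidPr.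
  have [ya|ya] := boolP (y \in supp a).
    left; apply/eqP/setIidPr/(subset_trans UL); apply/subsetP => x xL.
    by have [->//|xy] := eqVneq x y; rewrite (subsetP yS) // in_setD1 xy.
  right; apply/imsetP; exists y => //; apply/setP => x; rewrite in_setI in_setD1.
  have [->|xy] := eqVneq x y; first by rewrite (negPf ya).
  by case: (boolP (x \in L)); rewrite ?andbF // => xL; rewrite (subsetP yS) // in_setD1 xy.
- by move=> /eqP aU; left; apply/eqP/setIidPr; rewrite -aU subsetIl.
- move=> /eqP/setIidPr Ua; have [aL|] := eqVneq (supp a :&: L) U; first by right.
  move=> nL; left; apply/hsetP; left; split=> //.
  have /subsetPn[z] : ~~ (supp a :&: L \subset U).
    by apply: contra nL => h; rewrite eqEsubset h subsetI Ua.
  by rewrite in_setI => /andP[za zL] zU; exists z.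
- case/imsetP => y yU aL; left; apply/hsetP; right; exists y => //.
  by rewrite -aL subsetIl.
Qed.

End HiltonMilner.

(** * Compressed families *)

(** With [d = k - t] and [r = i - t] this is the profit condition for pushing traces of one size
    [i]. At [r = 1] it is the hypothesis on [m] itself. *)
Lemma push_same_size (t d m r : nat) : 0 < t -> 0 < r <= d -> t * d + 2 < m ->
  (t + r - 1) * (d - r + 1) < r * (m - 1 - r).
Proof.
case: t => // t _; case: r => // q /andP[_ qd] hm.
have [s ds] : exists s, d = q.+1 + s by exists (d - q.+1); lia.
have [u mu] : exists u, m = t.+1 * d + 3 + u by exists (m - (t.+1 * d + 3)); lia.
rewrite mu ds (_ : _ - _ - _ = t.+1 * (q.+1 + s) + 1 + u - q); last by lia.
rewrite (_ : t.+1 * (q.+1 + s) + 1 + u - q = t * (q.+1 + s) + s + 2 + u); last by nia.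
rewrite (_ : q.+1 + s - q.+1 + 1 = s.+1); last by lia.
by nia.
Qed.

Lemma bin_push (m k l i : nat) : 1 < i -> i <= k -> l <= m ->
  (k - i).+1 * 'C(m - l + k - 1, k - (i - 1)) = (m - l + i - 1) * 'C(m - l + k - 1, k - i).
Proof.
move=> i0 ik lm; have -> : k - (i - 1) = (k - i).+1 by lia.
by rewrite mul_bin_left; congr (_ * _); lia.
Qed.

Lemma bin_push_gt0 (m k l i : nat) : 0 < i -> i <= k -> l <= m -> 0 < 'C(m - l + k - 1, k - i).
Proof. by move=> i0 ik lm; rewrite bin_gt0; lia. Qed.

(** By [bin_push] each product of gains over losses has numerators [m - l + i - 1], [m - l + j - 1]
    and denominators [k - i + 1], [k - j + 1]. Pair them crosswise: as [i + j = l + t], the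
    numerator of [i] is [m + t - j - 1], which exceeds [k - j + 1]. *)
Lemma push_distinct_sizes (m t k l i j : nat) : t < k -> 0 < t -> t * (k - t) + 2 < m ->
  t < i <= k -> t < j <= k -> i + j = l + t -> l <= m ->
  'C(m - l + k - 1, k - i) * 'C(m - l + k - 1, k - j)
  < 'C(m - l + k - 1, k - (i - 1)) * 'C(m - l + k - 1, k - (j - 1)).
Proof.
move=> tk t0 hm /andP[ti ik] /andP[tj jk] ij lm.
have km : k + 2 < m + t.
  have : k - t <= t * (k - t) by rewrite leq_pmull.
  by lia.
have wi : 0 < 'C(m - l + k - 1, k - i) by apply: bin_push_gt0 => //; lia.
have wj : 0 < 'C(m - l + k - 1, k - j) by apply: bin_push_gt0 => //; lia.
have ei := bin_push (leq_ltn_trans t0 ti) ik lm.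
have ej := bin_push (leq_ltn_trans t0 tj) jk lm.
rewrite -(@ltn_pmul2l ((k - i).+1 * (k - j).+1)) //.
rewrite [ltnRHS]mulnACA ei ej mulnACA.
rewrite [ltnLHS]mulnACA [ltnRHS]mulnACA ltn_pmul2r ?muln_gt0 ?wi //.
rewrite [ltnLHS]mulnC; apply: ltn_mul; lia.
Qed.

(** Of [a] traces, [n] avoid a chosen point; the last hypothesis says that [n] is at least the
    average over the [l - 1] candidate points. Here [l - i = i - t]. *)
Lemma push_average (m t k l i a n : nat) : t < k -> 0 < t -> t * (k - t) + 2 < m ->
  t < i <= k -> i + i = l + t -> l <= m -> 0 < a -> n <= a -> a * (l - i) <= n * (l - 1) ->
  (a - n) * 'C(m - l + k - 1, k - i) < n * 'C(m - l + k - 1, k - (i - 1)).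
Proof.
move=> tk t0 hm /andP[ti ik] ii lm a0 na avg.
have wi : 0 < 'C(m - l + k - 1, k - i) by apply: bin_push_gt0 => //; lia.
have ei := bin_push (leq_ltn_trans t0 ti) ik lm.
have key := @push_same_size t (k - t) m (i - t) t0 _ hm.
have {}key : (i - 1) * (k - i).+1 < (l - i) * (m - l + i - 1).
  have -> : l - i = i - t by lia.
  have -> : m - l + i - 1 = m - 1 - (i - t) by lia.
  have -> : i - 1 = t + (i - t) - 1 by lia.
  have -> : (k - i).+1 = k - t - (i - t) + 1 by lia.
  by apply: key; lia.
have n0 : 0 < n.
  rewrite lt0n; apply: contraTneq avg => ->; rewrite mul0n leqn0 muln_eq0; lia.
have avg2 : (a - n) * (l - i) <= n * (i - 1).
  have -> : n * (i - 1) = n * (l - 1) - n * (l - i) by rewrite -mulnBr; congr (_ * _); lia.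
  by rewrite mulnBl leq_sub2r.
rewrite -(@ltn_pmul2l (k - i).+1) // [ltnRHS]mulnCA ei.
rewrite [ltnLHS]mulnA [ltnRHS]mulnA ltn_pmul2r //.
rewrite -(@ltn_pmul2r (l - i)); last by lia.
apply: (@leq_ltn_trans (n * ((i - 1) * (k - i).+1))).
  by rewrite -mulnA [leqLHS]mulnC mulnA leq_mul2r avg2 orbT.
by rewrite -[ltnRHS]mulnA ltn_pmul2l // [ltnRHS]mulnC.
Qed.

Lemma cards_D1 (T : finType) (E : {set T}) x : x \in E -> #|E| = #|E :\ x|.+1.
Proof. by move=> xE; rewrite (cardsD1 x) xE add1n. Qed.

Lemma cardsI_D1 (T : finType) (E G : {set T}) x : x \in E -> x \in G ->
  #|E :&: G| = #|(E :\ x) :&: (G :\ x)|.+1.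
Proof.
move=> xE xG; rewrite (cardsD1 x) in_setI xE xG add1n; congr #|pred_of_set _|.+1.
by apply/setP => y; rewrite !(in_setI, in_setD1); case: (y != x).
Qed.

(** * Generating sets of a swap-stable family with t-intersecting supports *)

Section Compressed.
Variables (m t k : nat) (F : {fset vec m}).
Hypotheses (t0 : 0 < t) (tk : t < k) (hm : t * (k - t) + 2 < m).
Hypotheses (mF : maxfam k t F) (cF : coreless F).
Hypothesis suppF : {in F &, forall a b : vec m, t <= #|supp a :&: supp b|}.
(** The swap of the two lowest points is exempt, because for [t = 1] it may make the family
    trivial. *)
Hypothesis stabF : forall i j : 'I_m, j < i -> 1 < i -> shift i j 0 F = F.
Implicit Types (a b : vec m) (S E G : {set 'I_m}).

Let fF : fam k t F := mF.1.

Definition upset S : bool := has (fun a => supp a \subset S) F.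

Lemma upsetP S : reflect (exists2 a : vec m, a \in F & supp a \subset S) (upset S).
Proof. by apply: (iffP hasP) => -[a]; exists a. Qed.

Lemma upsetW S E : S \subset E -> upset S -> upset E.
Proof.
by move=> SE /upsetP[a aF aS]; apply/upsetP; exists a => //; apply: subset_trans SE.
Qed.

Lemma upset_inter S E : upset S -> upset E -> t <= #|S :&: E|.
Proof.
move=> /upsetP[a aF aS] /upsetP[b bF bE]; apply: leq_trans (suppF aF bF) _.
by apply/subset_leq_card/setISS.
Qed.

Lemma upset_supp a : a \in F -> upset (supp a).
Proof. by move=> aF; apply/upsetP; exists a. Qed.

(** By maximality the family is determined by supports: a vector of weight [k] whose support
    contains that of a member overlaps all members in at least [t]. *)
Lemma upset_mem a : wt a = k -> upset (supp a) -> a \in F.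
Proof.
move=> wa ua; apply: (maxfam_closed mF (ltnW tk) wa) => b bF.
by apply: leq_trans (card_suppI_le a b); apply: upset_inter => //; apply: upset_supp.
Qed.

Lemma upset_shift S (x y : 'I_m) : x < y -> 1 < y -> y \in S -> x \notin S ->
  upset S -> upset (x |: S :\ y).
Proof.
move=> xy y1 yS xS /upsetP[a aF aS].
have nxy : y != x by apply: contraNneq xS => <-.
have [ya|ya] := boolP (y \in supp a); last first.
  apply/upsetP; exists a => //; apply/subsetP => w wa.
  rewrite in_setU1 in_setD1 (subsetP aS) // andbT orbC.
  by apply/orP; left; apply: contraNneq ya => <-.
have ax : mu a x = 0.
  by apply/eqP; rewrite -leqn0 leqNgt -in_supp; apply: contra xS; apply: (subsetP aS).
have da : shiftable y x 0 a by rewrite /shiftable ax -in_supp.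
apply/upsetP; exists (reflect_vec y x 0 a).
  exact: (shift_fixed (stabF xy y1) aF da).
apply/subsetP => w; rewrite in_supp in_setU1 in_setD1.
have [->|wy] := eqVneq w y; first by rewrite reflect_i ax.
have [->//|wx] := eqVneq w x.
by rewrite reflect_x //= -in_supp; apply: (subsetP aS).
Qed.

Definition initial l : {set 'I_m} := [set x : 'I_m | x < l].

Lemma card_initial l : l <= m -> #|initial l| = l.
Proof.
move=> lm; transitivity #|[set widen_ord lm x | x in 'I_l]|.
  congr #|pred_of_set _|; apply/setP => x; rewrite inE; apply/idP/imsetP => [xl|[y _ ->]].
    by exists (Ordinal xl) => //; apply: val_inj.
  by rewrite /= ltn_ord.
by rewrite card_imset ?card_ord // => x y /(congr1 val) /= /val_inj.
Qed.

Section Extent.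
Variables (l : nat) (z : 'I_m).
Hypotheses (zl : z.+1 = l) (l2 : 2 < l).
Hypothesis detl : forall S, upset S -> upset (S :&: initial l).
Local Notation L := (initial l).
Local Notation w e := ('C(m - l + k - 1, k - e)).

Let lm : l <= m. Proof. by rewrite -zl. Qed.
Let cL : #|L| = l. Proof. exact: card_initial. Qed.

(* The members of the generated up-set, traced on the initial segment [L], in which the last
   point [z] of [L] is essential. *)
Definition boundary : {set {set 'I_m}} :=
  [set E : {set 'I_m} | [&& E \subset L, upset E & ~~ upset (E :\ z)]].

Lemma boundary_z E : E \in boundary -> z \in E.
Proof.
rewrite inE => /and3P[_ uE]; apply: contraR => zE.
suff -> : E :\ z = E by [].
by apply/setP => x; rewrite in_setD1; case: eqP => // ->; rewrite (negPf zE).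
Qed.

Lemma in_L_lt x : x \in L -> x != z -> x < z.
Proof. by rewrite inE -zl ltnS leq_eqVlt => /orP[/eqP/val_inj ->|//]; rewrite eqxx. Qed.

Lemma z_gt1 : 1 < z. Proof. by rewrite -ltnS zl. Qed.

(** If [x] could be dropped, swapping [z] down to the vacated [x] would show that [z] could be
    dropped as well. *)
Lemma boundary_min E x : E \in boundary -> x \in E -> ~~ upset (E :\ x).
Proof.
move=> EB xE; have zE := boundary_z EB; move: EB; rewrite inE => /and3P[EL uE nE].
have [->//|xz] := eqVneq x z; apply: contra nE => uEx.
have : upset (x |: E :\ x :\ z).
  apply: upset_shift => //; rewrite ?in_L_lt ?z_gt1 ?(subsetP EL) //.
    by rewrite in_setD1 eq_sym xz.
  by rewrite in_setD1 eqxx.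
apply: upsetW; apply/subsetP => y; rewrite in_setU1 !in_setD1.
by case/orP => [/eqP ->|/and3P[-> _ ->]//]; rewrite xz.
Qed.

Lemma boundary_supp E : E \in boundary -> exists2 a : vec m, a \in F & supp a = E.
Proof.
move=> EB; have := EB; rewrite inE => /and3P[EL /upsetP[a aF aE] nE].
exists a => //; apply/eqP; rewrite eqEsubset aE; apply/subsetP => x xE.
apply: contraT => xa; case/negP: (boundary_min EB xE).
apply/upsetP; exists a => //; apply/subsetP => y ya; rewrite in_setD1 (subsetP aE) // andbT.
by apply: contraNneq xa => <-.
Qed.

(** A boundary set of size [t] would lie in the support of every member, making [z] a common
    element. *)
Lemma boundary_size E : E \in boundary -> t < #|E| <= k.
Proof.
move=> EB; have [a aF aE] := boundary_supp EB.
have [wF _ _] := famP _ _ _ fF.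
have -> : #|E| <= k by rewrite -aE -(wF a aF) card_supp_le.
have uE : upset E by rewrite -aE upset_supp.
have tE := upset_inter uE uE; rewrite setIid in tE; rewrite andbT ltn_neqAle tE andbT.
apply/eqP => tcE; have [b bF bz] := cF z.
have : E \subset supp b.
  have := upset_inter uE (upset_supp bF); rewrite tcE => h.
  by apply/setIidPl/eqP; rewrite eqEcard subsetIl.
by move/subsetP => /(_ z (boundary_z EB)); rewrite in_supp bz.
Qed.

Lemma boundary_sub E : E \in boundary -> E \subset L.
Proof. by rewrite inE => /and3P[]. Qed.

(** If some [x] of [L] were in neither set, swapping [z] for [x] in [E] would lose the common point
    [z] and gain none, leaving fewer than [t] common points. *)
Lemma boundary_cover E G : E \in boundary -> G \in boundary -> #|E :&: G| <= t ->
  E :|: G = L /\ #|E| + #|G| = l + t.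
Proof.
move=> EB GB cEG.
have := EB; rewrite inE => /and3P[EL uE _]; have := GB; rewrite inE => /and3P[GL uG _].
have cover : E :|: G = L.
  apply/eqP; rewrite eqEsubset subUset EL GL; apply/subsetP => x xL.
  apply: contraT; rewrite in_setU negb_or => /andP[xE xG].
  have xz : x != z by apply: contraNneq xE => ->; apply: boundary_z.
  have := upset_inter (upset_shift (in_L_lt xL xz) z_gt1 (boundary_z EB) xE uE) uG.
  have := cardsD1 z (E :&: G); rewrite in_setI !boundary_z //= => cz.
  have /subset_leq_card : (x |: E :\ z) :&: G \subset (E :&: G) :\ z.
    apply/subsetP => y; rewrite in_setI in_setU1 !in_setD1 in_setI.
    by case/andP => /orP[/eqP ->|/andP[-> ->] //]; rewrite (negPf xG).
  move=> h1 h2; have := leq_trans (leq_trans h2 h1) (leqnn _); have := cEG; rewrite cz add1n => h3 h4.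
  by have := leq_trans h3 h4; rewrite ltnn.
split=> //; rewrite -cardsUI cover cL; congr addn.
by apply/eqP; rewrite eqn_leq cEG upset_inter.
Qed.

Definition traces : {set {set 'I_m}} := [set E : {set 'I_m} | (E \subset L) && upset E].

Lemma trace_mem a : a \in F -> supp a :&: L \in traces.
Proof. by move=> aF; rewrite inE subsetIr detl // upset_supp. Qed.

Lemma F_traces : F = [fset a in vectors m k | supp a :&: L \in traces].
Proof.
have [wF _ _] := famP _ _ _ fF.
apply/fsetP => a; rewrite in_vectors_cond; apply/idP/andP => [aF|[/eqP wa]].
  by rewrite wF // trace_mem.
rewrite inE => /andP[_ uaL]; apply: upset_mem => //; apply: upsetW uaL; exact: subsetIl.
Qed.

(* Delete [z] from the traces in [P] and drop those in [Q].  A gain makes the new family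
   larger than [F], hence trivial, and that forces a trace L :\ y in [Q]. *)
Section Push.
Variables P Q : {set {set 'I_m}}.
Hypotheses (PB : P \subset boundary) (QB : Q \subset boundary).
Hypothesis PQ : forall E G, E \in P -> G \in boundary -> G \notin Q -> t < #|E :&: G|.
Hypothesis PnQ : {in P, forall E, E \notin Q}.
Hypothesis gain : \sum_(E in Q) w #|E| < \sum_(E in P) w (#|E| - 1).

Let pushed := [set E :\ z | E in P].
Let traces' := (traces :\: Q) :|: pushed.
Let F' := [fset a in vectors m k | supp a :&: L \in traces'].

Let inB E : E \in P -> E \in boundary. Proof. exact: (subsetP PB). Qed.

Lemma push_sub E : E \in traces' -> E \subset L.
Proof.
rewrite in_setU in_setD inE => /orP[/and3P[_ -> //]|/imsetP[E0 /inB E0B ->]].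
by apply: subset_trans (boundary_sub E0B); apply: subD1set.
Qed.

Lemma push_inter E G : E \in traces' -> G \in traces' -> t <= #|E :&: G|.
Proof.
have mixed E0 G0 : E0 \in P -> G0 \in traces -> G0 \notin Q -> t <= #|(E0 :\ z) :&: G0|.
  move=> E0P; rewrite inE => /andP[G0L uG0] G0Q.
  have := inB E0P; rewrite inE => /and3P[_ uE0 _].
  (* The deletion of [z] may be charged to either set. If [G0] survives it, nothing is lost; if not,
     [G0] is a boundary set and [PQ] provides a spare common point. *)
  have -> : (E0 :\ z) :&: G0 = E0 :&: (G0 :\ z).
    by apply/setP => x; rewrite !in_setI !in_setD1 andbCA andbA.
  have [uG0z|nG0z] := boolP (upset (G0 :\ z)); first exact: upset_inter.
  have G0B : G0 \in boundary by rewrite inE G0L uG0.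
  have := PQ E0P G0B G0Q; rewrite (cardsI_D1 (boundary_z (inB E0P)) (boundary_z G0B)).
  by rewrite ltnS => h; apply: leq_trans h _; apply/subset_leq_card/setSI/subD1set.
have both E0 G0 : E0 \in P -> G0 \in P -> t <= #|(E0 :\ z) :&: (G0 :\ z)|.
  move=> E0P G0P; have := PQ E0P (inB G0P) (PnQ G0P).
  by rewrite (cardsI_D1 (x := z)) ?boundary_z ?inB.
rewrite in_setU in_setD => /orP[/andP[EQ ET]|/imsetP[E0 E0P ->]];
  rewrite in_setU in_setD => /orP[/andP[GQ GT]|/imsetP[G0 G0P ->]].
- by move: ET GT; rewrite !inE => /andP[_ uE] /andP[_ uG]; apply: upset_inter.
- by rewrite setIC; apply: mixed.
- exact: mixed.
- exact: both.
Qed.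

Lemma push_notin E : E \in P -> E :\ z \notin traces.
Proof. by move=> /inB; rewrite !inE => /and3P[_ _ /negPf ->]; rewrite andbF. Qed.

Lemma push_trace E : E \in boundary -> E \in traces.
Proof. by rewrite !inE => /and3P[-> ->]. Qed.

Lemma push_card : #|` F| < #|` F'|.
Proof.
rewrite {1}F_traces (@card_traces _ _ L); last by move=> E; rewrite inE => /andP[].
rewrite (@card_traces _ _ L); last exact: push_sub.
set n := fun E => #|` [fset a in vectors m k | supp a :&: L == E]|.
rewrite (bigID (mem Q)) /= [ltnRHS](bigID (mem pushed)) /=.
have -> : \sum_(E in traces | E \in Q) n E = \sum_(E in Q) w #|E|.
  apply: eq_big => [E|E /andP[_ EQ]].
    by apply: andb_idl => EQ; rewrite push_trace ?(subsetP QB).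
  have EB := subsetP QB E EQ; have /andP[_ Ek] := boundary_size EB.
  by rewrite /n card_trace ?boundary_sub // cL.
have -> : \sum_(E in traces' | E \in pushed) n E = \sum_(E in P) w (#|E| - 1).
  transitivity (\sum_(E in pushed) n E).
    by apply: eq_bigl => E; apply: andb_idl => Ep; rewrite in_setU Ep orbT.
  rewrite big_imset /=; last first.
    move=> E G EP GP EG; apply/setP => x; have [->|xz] := eqVneq x z.
      by rewrite !boundary_z ?inB.
    by have /setP/(_ x) := EG; rewrite !in_setD1 xz.
  apply: eq_bigr => E EP; have EB := inB EP; have /andP[_ Ek] := boundary_size EB.
  have cEz : #|E :\ z| = #|E| - 1 by rewrite (cards_D1 (boundary_z EB)) subn1.
  rewrite /n card_trace ?cL ?cEz //; last by rewrite (leq_trans (leq_subr _ _)).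
  by apply: subset_trans (boundary_sub EB); apply: subD1set.
have -> : \sum_(E in traces' | E \notin pushed) n E = \sum_(E in traces | E \notin Q) n E.
  apply: eq_bigl => E; rewrite in_setU in_setD; have [Ep|Ep] := boolP (E \in pushed).
    rewrite andbF; case/imsetP: Ep => E0 E0P ->.
    by rewrite (negPf (push_notin E0P)).
  by rewrite orbF andbT andbC.
by rewrite ltn_add2r.
Qed.

(** The members with support [E] and their surplus at different points of [E] have only the
    indicator of [E] below all of them. When [E] has at most one point, the weight bound [t <= #|E|]
    takes over. *)
Lemma push_common (T : vec m) : wt T = t -> {in F', forall a x, mu T x <= mu a x} ->
  forall E, E \in traces' -> #|E| <= k -> forall x, mu T x <= (x \in E).
Proof.
move=> wT TF E ET Ek x; have tE := push_inter ET ET; rewrite setIid in tE.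
have pF' y : y \in E -> padded k E y \in F'.
  by move=> yE; rewrite in_vectors_cond wt_padded // supp_padded // eqxx (setIidPl (push_sub ET)).
have [xE|xE] := boolP (x \in E); last first.
  have /card_gt0P[y yE] : 0 < #|E| by lia.
  have := TF _ (pF' y yE) x; rewrite {2}/mu ffunE (negPf xE).
  by case: eqP => [xy|//]; rewrite -xy (negPf xE) in yE.
have [E1|E1] := leqP #|E| 1; first by have := leq_wt T x; rewrite wT => h; apply: leq_trans h _; lia.
have /card_gt0P[y] : 0 < #|E :\ x| by rewrite -ltnS -(cards_D1 xE).
rewrite in_setD1 => /andP[yx yE]; have := TF _ (pF' y yE) x.
by rewrite {2}/mu ffunE xE eq_sym (negPf yx).
Qed.

Lemma push_structure : exists U L0 : {set 'I_m},
  [/\ U \subset L0, #|U| = t, t + 2 <= #|L0| <= k + 1 & F = hfam k U L0].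
Proof.
have [wF oF nF] := famP _ _ _ fF.
have [nF'|/ntrivPn[T wT TF']] := boolP (ntriv t F').
  have fF' : fam k t F'.
    apply/famP; split=> // [a|a b]; first by rewrite in_vectors_cond => /andP[/eqP].
    rewrite !in_vectors_cond => /andP[_ aT] /andP[_ bT].
    apply: leq_trans (card_suppI_le a b); apply: leq_trans (push_inter aT bT) _.
    by apply/subset_leq_card/setISS; apply: subsetIl.
  by have := mF.2 _ fF'; rewrite leqNgt push_card.
have com := push_common wT TF'.
have /card_gt0P[E0 E0P] : 0 < #|P|.
  rewrite lt0n cards_eq0; apply: contraTneq gain => ->.
  by rewrite big_set0 ltn0.
have E0z : E0 :\ z \in traces' by rewrite in_setU; apply/orP; right; apply: imset_f.
have E0k : #|E0 :\ z| <= k.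
  have /andP[_] := boundary_size (inB E0P); apply: leq_trans.
  by apply/subset_leq_card/subD1set.
have T1 x : mu T x <= 1 by apply: leq_trans (com _ E0z E0k x) (leq_b1 _).
pose U := supp T.
have comU E : E \in traces' -> #|E| <= k -> U \subset E.
  move=> ET Ek; apply/subsetP => x; rewrite in_supp => Tx.
  by have := com E ET Ek x; case: (x \in E) => //; rewrite leqNgt Tx.
have UL : U \subset L by apply: subset_trans (comU _ E0z E0k) (push_sub E0z).
have cU : #|U| = t.
  rewrite -wT -sum1_card big_mkcond; apply: eq_bigr => x _; rewrite in_supp.
  by have := T1 x; case: (mu T x) => [|[]].
(* If [G] missed another point [x] of [L], trading [z] for [x] would give a trace without [z], which
   is not dropped; being small enough, it would contain [U], yet it misses [y]. *)
have dropped G y : G \in Q -> y \in U -> y \notin G -> G = L :\ y.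
  move=> GQ yU yG; have GB := subsetP QB G GQ.
  apply/eqP; rewrite eqEsubset; apply/andP; split.
    by rewrite subsetD1 yG boundary_sub.
  apply/subsetP => x; rewrite in_setD1 => /andP[xy xL]; apply: contraT => xG.
  have xz : x != z by apply: contraNneq xG => ->; apply: boundary_z.
  have zG := boundary_z GB.
  have uG : upset G by move: GB; rewrite inE => /and3P[].
  have uE := upset_shift (in_L_lt xL xz) z_gt1 zG xG uG.
  have zE : z \notin x |: G :\ z by rewrite in_setU1 in_setD1 eqxx eq_sym (negPf xz).
  have /comU : x |: G :\ z \in traces'.
    rewrite in_setU in_setD [_ \in traces]inE uE subUset sub1set xL.
    rewrite (subset_trans (subD1set _ _) (boundary_sub GB)) !andbT orbC.
    by apply/orP; right; apply: contra zE => /(subsetP QB)/boundary_z.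
  have /andP[_ Gk] := boundary_size GB.
  rewrite cardsU1 in_setD1 (negPf xG) andbF add1n -(cards_D1 zG).
  move=> /(_ Gk) /subsetP /(_ y yU); rewrite in_setU1 in_setD1 (negPf yG) andbF orbF.
  by rewrite eq_sym (negPf xy).
(* Since [F] is non-trivial, some member fails [T]. Its trace must have been dropped, hence is
   [L :\ x]; its size then bounds [#|L|] on both sides. *)
have [a aF [x Tx]] : exists2 a : vec m, a \in F & exists x, mu a x < mu T x.
  have : ~~ common T F by apply/negP => /commonP; apply: (ntrivP _ _ nF).
  case/allPn => a aF; rewrite negb_forall => /existsP[x]; rewrite -ltnNge => ax.
  by exists a => //; exists x.
have xU : x \in U by rewrite in_supp (leq_ltn_trans (leq0n _) Tx).
have xa : x \notin supp a by rewrite in_supp -leqNgt -ltnS (leq_trans Tx).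
have GQ : supp a :&: L \in Q.
  apply: contraT => GQ; have := TF' a; rewrite in_vectors_cond wF // eqxx in_setU in_setD.
  by rewrite GQ trace_mem //= => /(_ isT x); rewrite leqNgt Tx.
have xG : x \notin supp a :&: L by rewrite in_setI negb_and xa.
have Gx := dropped _ _ GQ xU xG.
have GB := subsetP QB _ GQ.
have cG : #|supp a :&: L| + 1 = l.
  by rewrite Gx addn1 -(cards_D1 (subsetP UL x xU)) cL.
have /andP[tG Gk] := boundary_size GB.
have tL : t + 2 <= #|L| by rewrite cL -cG addn2 addn1 !ltnS.
have Lk : #|L| <= k + 1 by rewrite cL -cG leq_add2r.
exists U, L; split=> //; first by rewrite tL.
apply: (maxfam_eq mF); first exact: hfam_fam.
apply/fsubsetP => b bF; rewrite in_hfam wF // eqxx -hset_trace //; apply/hsetP.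
have bT := trace_mem bF; have := bT; rewrite inE => /andP[bL ub].
have [Ub|/subsetPn[y yU yb]] := boolP (U \subset supp b :&: L).
  left; split=> //.
  have uG : upset (supp a :&: L) by move: GB; rewrite inE => /and3P[].
  (* The trace of [b] meets [L :\ x] in at least [t] points, of which only [t - 1] can be in [U]. *)
  have := upset_inter ub uG; rewrite Gx => h.
  have /subsetPn[y] : ~~ ((supp b :&: L) :&: (L :\ x) \subset U :\ x).
    by apply/negP => /subset_leq_card /(leq_trans h); rewrite leqNgt -cU (cards_D1 xU) ltnSn.
  rewrite in_setI [y \in L :\ x]in_setD1 in_setD1 => /and3P[yb yx yL].
  by rewrite yx /= => yU; exists y.
right; exists y => //; rewrite (dropped _ _ _ yU yb) //.
apply: contraT => bQ; move: yb; rewrite (subsetP (comU _ _ _) y yU) //.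
  by rewrite in_setU in_setD bQ bT.
by rewrite -(wF b bF); apply: leq_trans (card_supp_le b); apply/subset_leq_card/subsetIl.
Qed.

End Push.

Notation structured := (exists U L0 : {set 'I_m},
  [/\ U \subset L0, #|U| = t, t + 2 <= #|L0| <= k + 1 & F = hfam k U L0]).

Let layer (s : nat) := [set E in boundary | #|E| == s].

Lemma layerP s E : reflect (E \in boundary /\ #|E| = s) (E \in layer s).
Proof. by rewrite [X in reflect _ X]in_set; apply: (iffP andP) => -[EB /eqP].
Qed.

(** By [boundary_cover], only boundary traces of size [s'] can meet one of size [s] in as few as [t]
    points, so dropping that layer removes every conflict. *)
Lemma push_layer s s' : s + s' = l + t -> s != s' ->
  #|layer s'| * w s' < #|layer s| * w (s - 1) -> structured.
Proof.
move=> ss' ns gain; apply: (@push_structure (layer s) (layer s')).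
- by apply/subsetP => E /layerP[].
- by apply/subsetP => E /layerP[].
- move=> E G /layerP[EB Es] GB Gs'; rewrite ltnNge; apply: contra Gs'.
  case/(boundary_cover EB GB) => _; rewrite Es -ss' => /addnI cG.
  exact/layerP.
- move=> E /layerP[_ Es]; apply: contra ns => /layerP[_ <-]; exact/eqP.
rewrite (eq_bigr (fun=> w s')) => [|E /layerP[_ ->]//].
by rewrite [ltnRHS](eq_bigr (fun=> w (s - 1))) ?sum_nat_const => [|E /layerP[_ ->]].
Qed.

(** Two traces missing [x] do not cover [L], so they meet in more than [t] points; only the traces
    of size [s] through [x] are in conflict with them. *)
Lemma push_half s x : s + s = l + t -> x \in L -> x != z ->
  (#|layer s| - #|[set E in layer s | x \notin E]|) * w s
  < #|[set E in layer s | x \notin E]| * w (s - 1) -> structured.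
Proof.
move=> ss xL xz gain.
apply: (@push_structure [set E in layer s | x \notin E] [set E in layer s | x \in E]).
- by apply/subsetP => E; rewrite inE => /andP[/layerP[]].
- by apply/subsetP => E; rewrite inE => /andP[/layerP[]].
- move=> E G; rewrite inE => /andP[/layerP[EB Es] xE] GB; rewrite ltnNge; apply: contra.
  case/(boundary_cover EB GB) => EG; rewrite Es -ss => /addnI cG.
  rewrite inE; apply/andP; split; first exact/layerP.
  by move: xL; rewrite -EG in_setU (negPf xE).
- by move=> E; rewrite !inE => /andP[_ /negPf ->]; rewrite andbF.
rewrite (eq_bigr (fun=> w s)); last by move=> E; rewrite inE => /andP[/layerP[_ ->]].
rewrite [ltnRHS](eq_bigr (fun=> w (s - 1))); last first.
  by move=> E; rewrite inE => /andP[/layerP[_ ->]].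
rewrite !sum_nat_const; apply: leq_ltn_trans gain; rewrite leq_mul2r; apply/orP; right.
rewrite -(cardsID [set E : {set _} | x \in E] (layer s)).
have -> : layer s :\: [set E : {set _} | x \in E] = [set E in layer s | x \notin E].
  by apply/setP => E; rewrite in_setD !in_set andbC.
rewrite addnK; apply/subset_leq_card/subsetP => E; rewrite !in_set.
by case/andP => -> ->.
Qed.

(* Boundary traces meeting in exactly [t] points have sizes [i] and [j] with i + j = l + t.
   If i != j, pushing one size and dropping the other gains in one of the two directions;
   if i = j, push the traces missing a suitably chosen point. *)
Lemma boundary_structure E0 : E0 \in boundary -> structured.
Proof.
move=> E0B; have /andP[ti ik] := boundary_size E0B.
have il : #|E0| <= l by rewrite -cL; apply/subset_leq_card/boundary_sub.
pose i := #|E0|; pose j := l + t - i.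
have ij : i + j = l + t by rewrite /j subnKC // (leq_trans il) ?leq_addr.
have li0 : 0 < #|layer i| by apply/card_gt0P; exists E0; apply/layerP.
have [eij|nij] := eqVneq i j.
  rewrite -eij in ij.
  have il1 : i < l by move: ij ti il; rewrite -/i; clear; lia.
  have [/existsP[x /andP[xLz avg]]|] := boolP [exists x, (x \in L :\ z) &&
     (#|layer i| * (l - i) <= #|[set E in layer i | x \notin E]| * (l - 1))].
    move: xLz; rewrite in_setD1 => /andP[xz xL].
    apply: (push_half ij xL xz); apply: (push_average tk t0 hm _ ij lm li0 _ avg).
      by rewrite ti ik.
    by apply/subset_leq_card/subsetP => E; rewrite inE => /andP[].
  rewrite negb_exists => /forallP h; exfalso.
  have cLz : #|L :\ z| = l - 1.
    have zL : z \in L by rewrite inE zl.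
    by apply: succn_inj; rewrite -(cards_D1 zL) cL subn1 prednK // (leq_trans _ l2).
  (* Every trace of size [i] contains [z] and misses [l - i] of the other [l - 1] points, so not all
     points can be missed less often than average. *)
  have dc : \sum_(x in L :\ z) #|[set E in layer i | x \notin E]| = #|layer i| * (l - i).
    transitivity (\sum_(x in L :\ z) \sum_(E in layer i | x \notin E) 1).
      by apply: eq_bigr => x _; rewrite -sum1_card; apply: eq_bigl => E; rewrite in_set.
    rewrite (exchange_big_dep (mem (layer i))) /=; last by move=> x E _ /andP[].
    transitivity (\sum_(E in layer i) (l - i)); last exact: sum_nat_const.
    apply: eq_bigr => E El; have [EB Ei] := layerP _ _ El.
    transitivity #|L :\: E|; last by rewrite cardsDS ?boundary_sub // cL Ei.
    rewrite -[RHS]sum1_card; apply: eq_bigl => x; rewrite in_setD in_setD1 El /= andbC.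
    case: (boolP (x \in E)) => //= xE.
    by have [xz|//] := eqVneq x z; rewrite xz boundary_z in xE.
  have : \sum_(x in L :\ z) (#|[set E in layer i | x \notin E]| * (l - 1)).+1
         <= \sum_(x in L :\ z) #|layer i| * (l - i).
    apply: leq_sum => x xLz; have := h x.
    by rewrite xLz /= -ltnNge.
  rewrite sum_nat_const cLz; under eq_bigr do rewrite -addn1.
  rewrite big_split /= -big_distrl /= dc sum_nat_const cLz muln1 mulnC.
  by rewrite -[leqRHS]addn0 leq_add2l leqn0 subn_eq0 leqNgt (leq_trans _ l2).
have [lj|lj] := posnP #|layer j|.
  apply: (push_layer ij nij); rewrite lj mul0n muln_gt0 li0 bin_push_gt0 //.
    by move: ti; clear -t0; rewrite subn_gt0; apply: leq_trans.
  by apply: leq_trans ik; apply: leq_subr.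
have /card_gt0P[G /layerP[GB Gj]] := lj.
have jk := boundary_size GB; rewrite Gj in jk.
have [g1|g1] := ltnP (#|layer j| * w j) (#|layer i| * w (i - 1)).
  exact: push_layer ij nij g1.
have [g2|g2] := ltnP (#|layer i| * w i) (#|layer j| * w (j - 1)).
  by apply: push_layer g2; rewrite 1?addnC 1?eq_sym.
(* If both pushes fail, multiplying the two inequalities cancels the layer sizes. *)
have := leq_mul g1 g2; rewrite mulnACA [leqRHS]mulnACA [#|layer j| * _]mulnC.
rewrite leq_pmul2l ?muln_gt0 ?li0 // [leqRHS]mulnC leqNgt.
by rewrite (push_distinct_sizes tk t0 hm _ jk ij lm) // ti.
Qed.

End Extent.

Lemma compressed_structure : exists U L0 : {set 'I_m},
  [/\ U \subset L0, #|U| = t, t + 2 <= #|L0| <= k + 1 & F = hfam k U L0].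
Proof.
have exl : exists l, [forall S, upset S ==> upset (S :&: initial l)].
  exists m; apply/forallP => S; apply/implyP; apply: upsetW; apply/subsetP => x xS.
  by rewrite in_setI xS inE ltn_ord.
case: (ex_minnP exl) => l /forallP dl minl.
have det S : upset S -> upset (S :&: initial l) by move=> uS; apply: (implyP (dl S)).
have m2 : 2 < m by apply: leq_ltn_trans hm; rewrite leq_addl.
have lm : l <= m.
  apply: minl; apply/forallP => S; apply/implyP; apply: upsetW; apply/subsetP => x xS.
  by rewrite in_setI xS inE ltn_ord.
have l2 : 2 < l.
  (* With [l <= 2], a member avoiding point 0 and a member avoiding point 1 would have disjoint
     traces. *)
  rewrite ltnNge; apply/negP => l2.
  have [a aF a0] := cF (Ordinal (ltnW (ltnW m2))).
  have [b bF b1] := cF (Ordinal (ltnW m2)).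
  have := upset_inter (det _ (upset_supp aF)) (det _ (upset_supp bF)).
  suff -> : supp a :&: initial l :&: (supp b :&: initial l) = set0.
    by rewrite cards0 leqNgt t0.
  apply/setP => x; rewrite !in_setI !in_supp in_set0 inE.
  apply/negP => /andP[/andP[xa xl] /andP[xb _]].
  have : x < 2 by apply: leq_trans l2.
  case: (posnP x) => [x0|x0] x2.
    have xe : x = Ordinal (ltnW (ltnW m2)) by apply: val_inj.
    by rewrite xe a0 in xa.
  have xe : x = Ordinal (ltnW m2) by apply: val_inj => /=; apply/eqP; rewrite eqn_leq x0 -ltnS x2.
  by rewrite xe b1 in xb.
have zm : l.-1 < m by rewrite prednK // (leq_trans _ l2).
have zl : (Ordinal zm).+1 = l by rewrite /= prednK // (leq_trans _ l2).
(* Minimality of [l] yields a set whose trace on the first [l] points cannot spare the last one,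
   that is, a boundary set. *)
have /forallPn[S] : ~~ [forall S, upset S ==> upset (S :&: initial l.-1)].
  apply/negP => /minl; rewrite leqNgt; move: l2; clear; by case: l => // n _; rewrite ltnSn.
rewrite negb_imply => /andP[uS nS].
apply: (@boundary_structure l (Ordinal zm) zl l2 det (S :&: initial l)).
rewrite inE subsetIr det //=; apply: contra nS; apply: upsetW.
apply/subsetP => x; rewrite in_setD1 !in_setI !inE => /and3P[xz -> xl] /=.
move: xl; rewrite -zl ltnS leq_eqVlt => /orP[/eqP xe|//].
by case/eqP: xz; apply: val_inj.
Qed.

End Compressed.

(** * Undoing compressions *)

Lemma hset_imset m (s : {perm 'I_m}) (U L S : {set 'I_m}) :
  hset (s @: U) (s @: L) (s @: S) = hset U L S.
Proof.
have fwd (r : {perm 'I_m}) (U0 L0 S0 : {set 'I_m}) :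
    hset U0 L0 S0 -> hset (r @: U0) (r @: L0) (r @: S0).
  case/hsetP => [[US [z [zS zL zU]]]|[y yU yS]]; apply/hsetP; [left|right].
    split; first exact: imsetS.
    by exists (r z); rewrite !mem_imset //; apply: perm_inj.
  exists (r y); first exact: imset_f.
  apply/subsetP => x; rewrite in_setD1 => /andP[xy /imsetP[w wL xw]].
  rewrite xw imset_f // (subsetP yS) // in_setD1 wL andbT.
  by apply: contraNneq xy => wy; rewrite xw wy.
apply/idP/idP; last exact: fwd.
have inv (A : {set 'I_m}) : s^-1%g @: (s @: A) = A.
  rewrite -imset_comp -[RHS]imset_id; apply: eq_imset => x /=.
  by rewrite permK.
by move/(fwd s^-1%g); rewrite !inv.
Qed.

Lemma hset_imset_fix m (s : {perm 'I_m}) (U L S : {set 'I_m}) :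
  s @: U = U -> s @: L = L -> hset U L (s @: S) = hset U L S.
Proof. by move=> sU sL; rewrite -{1}sU -{1}sL hset_imset. Qed.

Lemma supp_reflect1 m (i j : 'I_m) (a : vec m) : i != j -> shiftable i j 1 a ->
  supp (reflect_vec i j 1 a) = j |: supp a.
Proof.
move=> ij da; apply/setP => x; rewrite in_setU1 !in_supp; move: da; rewrite /shiftable => da.
have [->|xi] := eqVneq x i.
  by rewrite reflect_i (negPf ij) addn1 /= (leq_ltn_trans _ da).
have [->|xj] := eqVneq x j; last by rewrite reflect_x.
by rewrite reflect_j // subn_gt0 (leq_trans _ da) // addn1.
Qed.

(** * Undoing a balancing *)

Section Backward.
Variables (m t k : nat) (U L : {set 'I_m}) (F : {fset vec m}) (i j : 'I_m).
Hypotheses (UL : U \subset L) (cU : #|U| = t) (t0 : 0 < t).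
Hypotheses (tL : t + 2 <= #|L|) (Lk : #|L| <= k + 1).
Hypotheses (fF : fam k t F) (ij : i != j).
Implicit Types (a b c : vec m) (S E : {set 'I_m}).
Local Notation H := (hfam k U L).

Let wF : {in F, forall a, wt a = k}. Proof. by case: (famP _ _ _ fF). Qed.
Let oF : {in F &, forall a b, t <= ov a b}. Proof. by case: (famP _ _ _ fF). Qed.

Let tk : t < k. Proof. by move: tL Lk; clear; lia. Qed.

Lemma card_LD1_le y : y \in U -> #|L :\ y| <= k.
Proof. by move=> yU; rewrite (card_LD1 UL cU t0 tL Lk) // leq_subLR addnC. Qed.

Lemma hset_outside S x : x \notin L -> hset U L (x |: S) = hset U L S.
Proof.
move=> xL; rewrite -(hset_trace UL) -[RHS](hset_trace UL); congr hset.
apply/setP => y; rewrite !in_setI in_setU1; case: eqP => //= ->.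
by rewrite (negPf xL) andbF.
Qed.

Lemma not_hset_LD1 S y : ~~ hset U L S -> y \in U -> ~~ (L :\ y \subset S).
Proof. by move=> nS yU; apply: contra nS => h; apply/hsetP; right; exists y. Qed.

Lemma not_hset_sub S z : ~~ hset U L S -> z \in L -> z \notin U -> ~~ (L :\ z \subset S).
Proof.
move=> nS zL zU; apply: contra nS => h; apply/hsetP; left.
have [w [wL wU wz]] := exists_LDU UL cU t0 tL Lk z.
split; last by exists w; rewrite (subsetP h) // in_setD1 wz.
apply: subset_trans h; apply/subsetP => x xU; rewrite in_setD1 (subsetP UL) // andbT.
by apply: contraNneq zU => <-.
Qed.

Lemma not_hset_LD S x : ~~ hset U L S -> x \in L -> ~~ (L :\ x \subset S).
Proof. by move=> nS xL; have [xU|xU] := boolP (x \in U); [exact: not_hset_LD1 | exact: not_hset_sub]. Qed.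

Lemma card_UD1 y : y \in U -> #|U :\ y| < t.
Proof. by move=> yU; rewrite -cU (cards_D1 yU). Qed.

Section Balancing.
Hypothesis shF : shift i j 1 F = H.
Local Notation rho := (reflect_vec i j 1).

Lemma unbalanced_supp a : a \in F -> a \notin H ->
  [/\ mu a j = 0, i \in supp a, hset U L (j |: supp a) & ~~ hset U L (supp a)].
Proof.
move=> aF aH; have := aH; rewrite -shF => /(shift_mem_notin aF)[da _].
rewrite shF in_hfam => /andP[_ hr].
have nh : ~~ hset U L (supp a) by move: aH; rewrite in_hfam wF // eqxx.
have sr : supp (rho a) = j |: supp a by apply: supp_reflect1.
rewrite -sr; split=> //; last by rewrite in_supp (leq_ltn_trans _ da).
apply/eqP; rewrite -leqn0 leqNgt -in_supp; apply: contra nh => ja.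
by move: hr; rewrite sr (setUidPr _) // sub1set.
Qed.

Lemma balanced_mem b : b \in H -> b \notin F ->
  exists2 a : vec m, a \in F /\ a \notin H & i \in supp b /\ supp b = j |: supp a.
Proof.
rewrite -{1}shF => bS bF; have [a [aF da eb aS]] := shift_notin_mem ij bS bF.
rewrite shF in aS; exists a => //; have [aj ia hj nh] := unbalanced_supp aF aS.
have sr : supp b = j |: supp a by rewrite eb supp_reflect1.
by rewrite sr in_setU1 ia orbT.
Qed.

(** If the vector were missing from [F], it would come from a member [a] vanishing at [j], and [i]
    would be in [E]. A balanced image has [i] in its support, so the vector on [L :\ i] did not
    arise that way and is in [F]; it overlaps [a] in fewer than [t]. *)
Lemma padded_mem E : hset U L E -> j \in E -> #|E| <= k -> j \in L ->
  (i \in E -> i \in U /\ #|(E :\ j) :&: (L :\ i)| < t) -> padded k E j \in F.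
Proof.
move=> hE jE Ek jL hi; have bH : padded k E j \in H by apply: padded_hfam.
apply: contraT => bF; have [a [aF aH] []] := balanced_mem bH bF.
rewrite supp_padded // => /hi[iU small] eE.
have [aj ia _ _] := unbalanced_supp aF aH.
have jLi : j \in L :\ i by rewrite in_setD1 eq_sym ij.
have cLi := card_LD1_le iU.
have CF : padded k (L :\ i) j \in F.
  have CH : padded k (L :\ i) j \in H by apply: padded_hfam; rewrite ?hset_LD1.
  apply: contraT => CF; have [c _ [ic _]] := balanced_mem CH CF.
  by move: ic; rewrite supp_padded // in_setD1 eqxx.
have := oF aF CF; rewrite ov_padded // leqNgt => /negP[]; apply: leq_ltn_trans small.
apply/subset_leq_card/subsetP => x; rewrite in_setI => /andP[xa xL].
rewrite in_setI xL eE in_setD1 in_setU1 xa orbT !andbT.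
by apply: contraTneq xa => ->; rewrite in_supp aj.
Qed.

(** A member [a] outside [H] vanishes at [j] and fits the shape only once [j] is added. In each case
    some padded vector of [F], with its surplus at [j], overlaps [a] in fewer than [t]. *)
Lemma unbalance_hfam : F = H.
Proof.
apply/eqP; rewrite eqEfcard -shF card_shift // leqnn andbT shF; apply/fsubsetP => a aF.
apply: contraT => aH; have [aj ia hj nh] := unbalanced_supp aF aH.
have ja : j \notin supp a by rewrite in_supp aj.
have jL : j \in L by apply: contraT => jL; rewrite hset_outside // (negPf nh) in hj.
have bad E : padded k E j \in F -> #|supp a :&: E| < t -> false.
  by move=> EF; rewrite ltnNge; have := oF aF EF; rewrite ov_padded // => ->.
(* The test set is [z |: U]: [a] misses [j], and in addition either [z] or a second point of [U]. *)
have [jU|jU] := boolP (j \in U).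
  have [z [zL zU zi small]] : exists z, [/\ z \in L, z \notin U, z != i &
      #|supp a :&: (z |: U)| < t].
    case/hsetP: hj => [[Ua _]|[y yU yS]].
      have /subsetPn[z] := not_hset_LD nh jL; rewrite in_setD1 => /andP[zj zL] za.
      have zU : z \notin U.
        by apply: contra za => /(subsetP Ua); rewrite in_setU1 (negPf zj).
      exists z; split=> //; first by apply: contraNneq za => ->.
      apply: leq_ltn_trans (card_UD1 jU); apply/subset_leq_card/subsetP => x.
      rewrite in_setI in_setU1 in_setD1 => /andP[xa /orP[/eqP xz|->]].
        by rewrite xz (negPf za) in xa.
      by rewrite andbT; apply: contraTneq xa => ->.
    have yj : y != j.
      apply: contraNneq (not_hset_LD nh jL) => yj; rewrite yj in yS.
      apply/subsetP => x xL; have := subsetP yS x xL; rewrite in_setU1.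
      by move: xL; rewrite in_setD1 => /andP[/negPf ->].
    have ya : y \notin supp a.
      apply: contraNN (not_hset_LD nh jL) => ya; apply/subsetP => x; rewrite in_setD1 => /andP[xj xL].
      have [->//|xy] := eqVneq x y.
      by have := subsetP yS x; rewrite in_setD1 xy xL in_setU1 (negPf xj) => /(_ isT).
    have [z [zL zU zi]] := exists_LDU UL cU t0 tL Lk i.
    exists z; split=> //; apply: (@leq_ltn_trans #|z |: (U :\ y :\ j)|).
      apply/subset_leq_card/subsetP => x; rewrite in_setI !in_setU1 !in_setD1.
      case/andP => xa /orP[->//|->]; rewrite andbT; apply/orP; right.
      by apply/andP; split; [apply: contraTneq xa => -> | apply: contraTneq xa => ->].
    have jUy : j \in U :\ y by rewrite in_setD1 eq_sym yj.
    have := card_UD1 yU; rewrite (cards_D1 jUy) cardsU1 => h; apply: leq_ltn_trans h.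
    by rewrite -add1n leq_add2r leq_b1.
  apply: bad small; apply: padded_mem => //.
  - exact: hset_U1.
  - by rewrite in_setU1 jU orbT.
  - by rewrite (card_U1 cU).
  rewrite in_setU1 eq_sym (negPf zi) /= => iU; split=> //.
  apply: (@leq_ltn_trans #|z |: (U :\ j :\ i)|).
    apply/subset_leq_card/subsetP => x; rewrite in_setI !in_setD1 !in_setU1 !in_setD1.
    by case/andP => /andP[-> /orP[->//|->]] /andP[-> _]; rewrite orbT.
  have iUj : i \in U :\ j by rewrite in_setD1 ij.
  have := card_UD1 jU; rewrite (cards_D1 iUj) cardsU1 => h; apply: leq_ltn_trans h.
  by rewrite -add1n leq_add2r leq_b1.
(* If the support of [a] meets [L] exactly in [U], the test set is some [L :\ y] avoiding [i]; if
   [a] misses a point of [U], it is [j |: U]. *)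
case/hsetP: hj => [[Ua _]|[y yU yS]].
  have {}Ua : U \subset supp a.
    apply/subsetP => x xU; have := subsetP Ua x xU; rewrite in_setU1.
    by case: eqP => // xj; rewrite -xj xU in jU.
  have aL x : x \in supp a -> x \in L -> x \in U.
    move=> xa xL; apply: contraT => xU; case/negP: nh; apply/hsetP; left; split=> //.
    by exists x.
  have [y yU iy] : exists2 y, y \in U & i \notin L :\ y.
    have [iU|iU] := boolP (i \in U); first by exists i; rewrite ?in_setD1 ?eqxx.
    have /card_gt0P[y yU] : 0 < #|U| by rewrite cU.
    exists y => //; rewrite in_setD1 negb_and; apply/orP; right.
    by apply: contra iU; apply: aL.
  apply: (bad (L :\ y)).
    apply: padded_mem => //; first exact: hset_LD1.
    - by rewrite in_setD1 jL andbT; apply: contraNneq jU => ->.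
    - exact: card_LD1_le.
    by rewrite (negPf iy).
  apply: leq_ltn_trans (card_UD1 yU); apply/subset_leq_card/subsetP => x.
  by rewrite in_setI !in_setD1 => /and3P[xa -> xL]; rewrite aL.
have ya : y \notin supp a.
  apply: contraNN (not_hset_LD nh jL) => ya; apply/subsetP => x; rewrite in_setD1 => /andP[xj xL].
  have [->//|xy] := eqVneq x y.
  by have := subsetP yS x; rewrite in_setD1 xy xL in_setU1 (negPf xj) => /(_ isT).
apply: (bad (j |: U)).
  apply: padded_mem => //; rewrite ?setU11 //; first exact: hset_U1.
    by rewrite (card_U1 cU).
  rewrite in_setU1 (negPf ij) /= => iU; split=> //; apply: leq_ltn_trans (card_UD1 iU).
  apply/subset_leq_card/subsetP => x; rewrite in_setI !in_setD1 in_setU1.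
  by case/andP => /andP[/negPf ->] /= -> /andP[->].
apply: leq_ltn_trans (card_UD1 yU); apply/subset_leq_card/subsetP => x.
rewrite in_setI in_setU1 in_setD1 => /andP[xa /orP[/eqP xj|->]].
  by rewrite xj (negPf ja) in xa.
by rewrite andbT; apply: contraTneq xa => ->.
Qed.

End Balancing.
End Backward.

(** * Undoing a swap *)

Section Swap.
Variables (m t k : nat) (U L : {set 'I_m}) (F : {fset vec m}) (i j : 'I_m).
Hypotheses (UL : U \subset L) (cU : #|U| = t) (t0 : 0 < t).
Hypotheses (tL : t + 2 <= #|L|) (Lk : #|L| <= k + 1).
Hypotheses (fF : fam k t F) (ij : i != j).
Implicit Types (a b c : vec m) (S E : {set 'I_m}).
Local Notation H := (hfam k U L).
Local Notation rho := (reflect_vec i j 0).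
Hypothesis shF : shift i j 0 F = H.

Let wF : {in F, forall a, wt a = k}. Proof. by case: (famP _ _ _ fF). Qed.
Let oF : {in F &, forall a b, t <= ov a b}. Proof. by case: (famP _ _ _ fF). Qed.
Let tk : t < k. Proof. by move: tL Lk; clear; lia. Qed.

Lemma reflect0K : involutive rho.
Proof. by move=> a; apply: reflectK. Qed.

Lemma wt_reflect0 a : wt (rho a) = wt a.
Proof.
rewrite /wt !(sum_pair _ ij) reflect_i reflect_j // addn0 subn0 [mu a j + _]addnC.
by rewrite (eq_sum_pair (g := mu a)) => // x xi xj; rewrite reflect_x.
Qed.

Lemma supp_reflect0 a : supp (rho a) = tperm i j @: supp a.
Proof.
apply/setP => x; rewrite -{2}(tpermK i j x) mem_imset; last exact: perm_inj.
rewrite !in_supp; case: tpermP => [->|->|xi xj].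
- by rewrite reflect_i addn0.
- by rewrite reflect_j // subn0.
by rewrite reflect_x //; apply/eqP.
Qed.

(* [F] agrees with [H] except that it may contain some ambiguous [a] instead of [rho a];
   the point is that this choice is the same for all ambiguous [a]. *)
Definition ambiguous a := [/\ wt a = k, shiftable i j 0 a, rho a \in H & a \notin H].

Lemma ambiguousP a : ambiguous a -> [/\ mu a j = 0, i \in supp a,
  hset U L (j |: supp a :\ i) & ~~ hset U L (supp a)].
Proof.
move=> [wa da]; rewrite !in_hfam wt_reflect0 wa eqxx /= => hr ha.
have ia : i \in supp a by rewrite in_supp (leq_ltn_trans _ da).
have ja : mu a j = 0.
  apply/eqP; rewrite -leqn0 leqNgt -in_supp; apply: contra ha => ja.
  suff <- : supp (rho a) = supp a by [].
  apply/setP => x; rewrite !in_supp.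
  have [->|xi] := eqVneq x i; first by rewrite reflect_i addn0 -!in_supp ia ja.
  have [->|xj] := eqVneq x j; first by rewrite reflect_j // subn0 -!in_supp ia ja.
  by rewrite reflect_x.
split=> //; suff <- : supp (rho a) = j |: supp a :\ i by [].
apply/setP => x; rewrite in_setU1 in_setD1 !in_supp.
have [->|xi] := eqVneq x i; first by rewrite reflect_i (negPf ij) ja.
have [->|xj] := eqVneq x j; first by rewrite reflect_j // subn0 -in_supp ia.
by rewrite reflect_x.
Qed.

Lemma ambiguous_mem a : ambiguous a -> (a \in F) = (rho a \notin F).
Proof.
move=> [wa da rH aH]; apply/idP/idP => [aF|rF].
  by move: aH; rewrite -shF => /(shift_mem_notin aF)[].
move: rH; rewrite -shF => rH; have [b [bF db e _]] := shift_notin_mem ij rH rF.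
by rewrite (reflect_inj ij da db e).
Qed.

Lemma ambiguous_padded E : i \in E -> j \notin E -> #|E| <= k -> hset U L (j |: E :\ i) ->
  ~~ hset U L E -> ambiguous (padded k E i).
Proof.
move=> iE jE Ek hr hE; have sE := supp_padded k iE; split.
- exact: wt_padded.
- have : i \in supp (padded k E i) by rewrite sE.
  have : j \notin supp (padded k E i) by rewrite sE.
  by rewrite !in_supp /shiftable -leqNgt leqn0 addn0 => /eqP ->.
- rewrite in_hfam wt_reflect0 wt_padded // eqxx supp_reflect0 sE.
  suff -> : tperm i j @: E = j |: E :\ i by [].
  apply/setP => x; rewrite -{1}(tpermK i j x) mem_imset; last exact: perm_inj.
  rewrite in_setU1 in_setD1; case: tpermP => [->|->|/eqP xi /eqP xj].
  + by rewrite eqxx (negPf ij) (negPf jE).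
  + by rewrite eqxx iE.
  by rewrite xi (negPf xj).
- by rewrite in_hfam sE negb_and hE orbT.
Qed.

(** Neither [c] with the reflected padded vector, nor the padded vector with the reflected [c], can
    lie together in [F], since both overlaps are below [t]. *)
Lemma ambiguous_link E c : i \in E -> ambiguous (padded k E i) -> ambiguous c ->
  #|supp c :&: (E :\ i)| < t -> (c \in F) = (padded k E i \in F).
Proof.
move=> iE Eamb camb small; have [bj _ _ _] := ambiguousP Eamb.
have [cj ic _ _] := ambiguousP camb.
have Ej : j \notin E by rewrite -(supp_padded k iE) in_supp bj.
have small' : ov c (rho (padded k E i)) < t.
  apply: leq_ltn_trans small; rewrite (ov_pair ij) reflect_i reflect_j // bj cj.
  rewrite min0n minn0 !add0n -sum1_card [leqRHS]big_mkcond [leqLHS]big_mkcond /=.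
  apply: leq_sum => x _; case: ifP => // /andP[xi xj].
  rewrite reflect_x // in_setI in_setD1 xi in_supp /= [mu (padded _ _ _) _]ffunE (negPf xi).
  by case: (x \in E); rewrite ?andbT ?andbF ?minn0 //; case: (mu c x) => //= n; rewrite geq_minr.
have dE : shiftable i j 0 (padded k E i) by case: Eamb.
have dc : shiftable i j 0 c by case: camb.
apply/idP/idP => [cF|EF]; apply: contraT => nF.
  have := ambiguous_mem Eamb; rewrite (negPf nF) => /esym/negbT; rewrite negbK => rF.
  by have := oF cF rF; rewrite leqNgt small'.
have := ambiguous_mem camb; rewrite (negPf nF) => /esym/negbT; rewrite negbK => rF.
by have := oF EF rF; rewrite -ov_reflect_r // ovC leqNgt small'.
Qed.

Lemma tperm_imset S : (i \in S) = (j \in S) -> tperm i j @: S = S.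
Proof.
move=> ijS; apply/setP => x; rewrite -{1}(tpermK i j x) mem_imset; last exact: perm_inj.
by case: tpermP => // ->.
Qed.

Lemma ambiguous_asym a : ambiguous a -> ~ ((i \in U) = (j \in U) /\ (i \in L) = (j \in L)).
Proof.
move=> [wa da]; rewrite !in_hfam wt_reflect0 wa eqxx /= supp_reflect0 => hr ha [iU iL].
by move: hr; rewrite hset_imset_fix ?tperm_imset // (negPf ha).
Qed.

Lemma ambiguous_jL a : ambiguous a -> j \in L.
Proof.
case/ambiguousP => _ ia hr ha; apply: contraT => jL.
move: hr; rewrite hset_outside // => /(hsetW (subD1set _ _)); exact: contraTT.
Qed.

Lemma ambiguous_iU a : ambiguous a -> i \notin U.
Proof.
move=> amb; have jL := ambiguous_jL amb; apply/negP => iU.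
have [jU|jU] := boolP (j \in U).
  by apply: (ambiguous_asym amb); rewrite jL iU jU (subsetP UL).
have [_ ia hr ha] := ambiguousP amb.
case/hsetP: hr => [[Ua _]|[y yU yS]].
  by have := subsetP Ua i iU; rewrite in_setU1 in_setD1 eqxx (negPf ij).
have yi : y = i.
  apply/eqP; apply: contraT => yi; have := subsetP yS i.
  by rewrite !in_setU1 !in_setD1 eqxx (negPf ij) eq_sym yi (subsetP UL) // => /(_ isT).
case/negP: (not_hset_LD UL cU t0 tL Lk ha jL); apply/subsetP => x; rewrite in_setD1 => /andP[xj xL].
have [->//|xi] := eqVneq x i.
by have := subsetP yS x; rewrite yi in_setU1 !in_setD1 xi xL (negPf xj) => /(_ isT).
Qed.

Lemma ambiguous_cases a : ambiguous a ->
  (U :\ j \subset supp a /\ exists z, [/\ z \in supp a, z \in L, z \notin U & z != i] \/ z = j /\ z \notin U)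
  \/ exists y, [/\ y \in U, y != j, y \notin supp a, i \notin L & L :\ y :\ j \subset supp a].
Proof.
move=> amb; have jL := ambiguous_jL amb; have iU := ambiguous_iU amb.
have [_ ia hr ha] := ambiguousP amb.
have nLj := not_hset_LD UL cU t0 tL Lk ha jL.
case/hsetP: hr => [[Ua [z [zS zL zU]]]|[y yU yS]]; [left|right].
  split.
    apply/subsetP => x; rewrite in_setD1 => /andP[xj xU].
    by have := subsetP Ua x xU; rewrite in_setU1 (negPf xj) in_setD1 => /andP[].
  exists z; move: zS; rewrite in_setU1 in_setD1 => /orP[/eqP zj|/andP[zi za]]; first by right.
  by left.
have sub x : x \in L -> x != y -> x != j -> x \in supp a /\ x != i.
  move=> xL xy xj; have := subsetP yS x.
  by rewrite in_setD1 xy xL in_setU1 (negPf xj) in_setD1 => /(_ isT)/andP[].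
exists y; split=> //.
- apply: contraNneq nLj => yj; apply/subsetP => x; rewrite in_setD1 => /andP[xj xL].
  by case: (sub x); rewrite ?yj.
- apply: contraNN nLj => ya; apply/subsetP => x; rewrite in_setD1 => /andP[xj xL].
  by have [->//|xy] := eqVneq x y; case: (sub x).
- apply: contraNN iU => iL; have [->//|iy] := eqVneq i y.
  by case: (sub i iL iy ij) => _; rewrite eqxx.
by apply/subsetP => x; rewrite !in_setD1 => /and3P[xj xy xL]; case: (sub x).
Qed.

(** A few padded vectors serve as hubs: [ambiguous_link] ties every ambiguous vector to a hub and
    the hubs to one another. *)
Lemma ambiguous_uniform a b : ambiguous a -> ambiguous b -> (a \in F) = (b \in F).
Proof.
move=> ambA ambB; have jL := ambiguous_jL ambA; have iU := ambiguous_iU ambA.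
have nLj c : ambiguous c -> ~~ (L :\ j \subset supp c).
  by case/ambiguousP => _ _ _ hc; apply: (not_hset_LD UL cU t0 tL Lk hc jL).
have [jU|jU] := boolP (j \in U).
  (* The hubs are the sets [B z]. For distinct [z], [z'] the set [B z] meets [z' |: U :\ j] only
     within [U :\ j], which has [t - 1] points. *)
  pose B z := i |: (z |: U :\ j).
  have BD z : z != i -> B z :\ i = z |: U :\ j.
    by move=> zi; rewrite setU1K // in_setU1 in_setD1 eq_sym (negPf zi) (negPf iU) andbF.
  have Bamb z z' : [/\ z \in L, z \notin U & z != i] -> [/\ z' \in L, z' \notin U, z' != i & z' != z] ->
      ambiguous (padded k (B z) i).
    move=> [zL zU zi] [zL' zU' zi' zz'].
    have zj : z != j by apply: contraNneq zU => ->.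
    apply: ambiguous_padded; first exact: setU11.
    - by rewrite !in_setU1 in_setD1 eqxx eq_sym (negPf ij) eq_sym (negPf zj).
    - rewrite (cardsD1 i) setU11 BD // cardsU1 in_setD1 (negPf zU) andbF.
      by have := tk; rewrite -cU (cards_D1 jU) !add1n.
    - rewrite BD // setUCA setD1K //; exact: hset_U1.
    apply/hsetP => -[[UB _]|[y yU yB]].
      have := subsetP UB j jU; rewrite !in_setU1 in_setD1 eqxx.
      by rewrite eq_sym (negPf ij) eq_sym (negPf zj).
    have yj : y = j.
      apply/eqP; apply: contraT => yj; have := subsetP yB j.
      by rewrite in_setD1 eq_sym yj jL !in_setU1 in_setD1 eqxx eq_sym (negPf ij) eq_sym (negPf zj) => /(_ isT).
    have := subsetP yB z'; rewrite yj in_setD1 zL' andbT.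
    have zj' : z' != j by apply: contraNneq zU' => ->.
    by rewrite zj' !in_setU1 (negPf zi') (negPf zz') in_setD1 (negPf zU') andbF => /(_ isT).
  have Blink c z : ambiguous c -> ambiguous (padded k (B z) i) -> z != i ->
      #|supp c :&: (z |: U :\ j)| < t -> (c \in F) = (padded k (B z) i \in F).
    by move=> ambc ambz zi small; apply: ambiguous_link; rewrite ?setU11 ?BD.
  have Uj : #|U :\ j| < t by apply: card_UD1.
  have toB c : ambiguous c -> exists z, [/\ [/\ z \in L, z \notin U & z != i],
      ambiguous (padded k (B z) i) & (c \in F) = (padded k (B z) i \in F)].
    move=> ambc; have [[Uc [z1 [[z1c z1L z1U z1i]|[-> ]]]]|[y [yU yj yc iL yS]]] := ambiguous_cases ambc.
    - have /subsetPn[z] := nLj c ambc; rewrite in_setD1 => /andP[zj zL] zc.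
      have zU : z \notin U by apply: contra zc => zU; apply: (subsetP Uc); rewrite in_setD1 zj.
      have [_ ic _ _] := ambiguousP ambc.
      have zi : z != i by apply: contraNneq zc => ->.
      have zB : ambiguous (padded k (B z) i).
        apply: (@Bamb z z1); split=> //; apply: contraNneq zc => <-; exact: z1c.
      exists z; split=> //; apply: Blink => //; apply: leq_ltn_trans Uj.
      apply/subset_leq_card/subsetP => x; rewrite in_setI in_setU1.
      by case/andP => xc /orP[/eqP xz|//]; rewrite -xz xc in zc.
    - by rewrite jU.
    have [z [zL zU zi]] := exists_LDU UL cU t0 tL Lk i.
    have [z' [zL' zU' zz']] := exists_LDU UL cU t0 tL Lk z.
    have zB : ambiguous (padded k (B z) i).
      by apply: (@Bamb z z'); split=> //; apply: contraNneq iL => <-.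
    exists z; split=> //; apply: Blink => //.
    have yUj : y \in U :\ j by rewrite in_setD1 yj.
    move: Uj; rewrite (cards_D1 yUj) => h; apply: leq_ltn_trans h.
    apply: (@leq_trans #|z |: (U :\ j :\ y)|).
      apply/subset_leq_card/subsetP => x; rewrite in_setI !in_setU1 [in X in _ -> _ || X]in_setD1.
      case/andP => xc /orP[->//|->]; rewrite andbT; apply/orP; right.
      by apply: contraNneq yc => <-.
    by rewrite cardsU1 -add1n leq_add2r leq_b1.
  have [z [[zL zU zi] zB ->]] := toB a ambA.
  have [z' [[zL' zU' zi'] zB' ->]] := toB b ambB.
  have [->//|zz'] := eqVneq z z'.
  apply: Blink => //; apply: leq_ltn_trans Uj; rewrite supp_padded ?setU11 //.
  apply/subset_leq_card/subsetP => x; rewrite in_setI [_ \in z' |: _]in_setU1 => /andP[xB].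
  case/orP => [/eqP xz'|//]; move: xB; rewrite xz' !in_setU1 (negPf zi') eq_sym (negPf zz').
  by rewrite in_setD1 => /andP[_ z'U]; rewrite z'U in zU'.
have iL : i \notin L.
  by apply/negP => iL; apply: (ambiguous_asym ambA); rewrite iL jL (negPf iU) (negPf jU).
have /card_gt0P[y0 y0U] : 0 < #|U| by rewrite cU.
have y0j : y0 != j by apply: contraNneq jU => <-.
have y0L := subsetP UL y0 y0U.
have UjU : U :\ j = U.
  by apply/setP => x; rewrite in_setD1; case: eqP => // ->; rewrite (negPf jU).
(* The two hubs reflect to [j |: U] and to [L :\ y0]. Vectors containing [U] are tied to [B2], those
   missing a point of [U] to [B1]. *)
pose B1 := i |: U; pose B2 := i |: (L :\ y0 :\ j).
have B1D : B1 :\ i = U by rewrite setU1K.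
have B2D : B2 :\ i = L :\ y0 :\ j by rewrite setU1K // !in_setD1 (negPf iL) !andbF.
have jLy : j \in L :\ y0 by rewrite in_setD1 eq_sym y0j.
have cLy := card_LD1_le UL cU t0 tL Lk y0U.
have UB1 : ambiguous (padded k B1 i).
  apply: ambiguous_padded; first exact: setU11.
  - by rewrite in_setU1 eq_sym (negPf ij).
  - by rewrite cardsU1 iU cU.
  - by rewrite B1D; apply: hset_U1.
  rewrite hset_outside //; apply/hsetP => -[[_ [z [zU _]]]|[y yU yS]]; first by rewrite zU.
  have := subset_leq_card yS; rewrite cU; have := cards_D1 (subsetP UL y yU).
  by move: tL; clear; lia.
have LB2 : ambiguous (padded k B2 i).
  apply: ambiguous_padded; first exact: setU11.
  - by rewrite in_setU1 !in_setD1 eqxx eq_sym (negPf ij).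
  - by rewrite cardsU1 !in_setD1 (negPf iL) !andbF add1n -(cards_D1 jLy).
  - by rewrite B2D setD1K //; apply: hset_LD1.
  rewrite hset_outside //; apply/hsetP => -[[US _]|[y yU yS]].
    by have := subsetP US y0 y0U; rewrite !in_setD1 eqxx andbF.
  have := subset_leq_card yS.
  by rewrite -ltnS -(cards_D1 (subsetP UL y yU)) (cards_D1 y0L) (cards_D1 jLy) ltnS ltnn.
have L12 : (padded k B2 i \in F) = (padded k B1 i \in F).
  apply: ambiguous_link; rewrite ?setU11 // B1D supp_padded ?setU11 //.
  apply: leq_ltn_trans (card_UD1 cU y0U); apply/subset_leq_card/subsetP => x.
  rewrite in_setI in_setU1 !in_setD1 => /andP[/orP[/eqP ->|/and3P[_ -> _]->//]].
  by rewrite (negPf iU).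
suff all1 c : ambiguous c -> (c \in F) = (padded k B1 i \in F) by rewrite !all1.
move=> ambc; have [_ ic _ hc] := ambiguousP ambc.
have [[Uc _]|[y [yU yj yc _ yS]]] := ambiguous_cases ambc; last first.
  apply: ambiguous_link; rewrite ?setU11 // B1D; apply: leq_ltn_trans (card_UD1 cU yU).
  apply/subset_leq_card/subsetP => x; rewrite in_setI in_setD1 => /andP[xc ->].
  by rewrite andbT; apply: contraNneq yc => <-.
rewrite -L12; apply: ambiguous_link; rewrite ?setU11 // B2D.
apply: leq_ltn_trans (card_UD1 cU y0U); apply/subset_leq_card/subsetP => x.
rewrite in_setI !in_setD1 => /and4P[xc xj -> xL] /=; apply: contraNT hc => xU.
by apply/hsetP; left; split; [rewrite -UjU | exists x].
Qed.

(** Either [F] is [H], or one ambiguous vector is in [F]; then all of them are, and [F] is the image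
    of [H] under the transposition of [i] and [j]. *)
Lemma swap_hfam : exists U' L' : {set 'I_m},
  [/\ U' \subset L', #|U'| = t, #|L'| = #|L| & F = hfam k U' L'].
Proof.
have cF : #|` F| = #|` H| by rewrite -shF card_shift.
have [FH|/fsubsetPn[a aF aH]] := boolP (F `<=` H).
  by exists U, L; split=> //; apply/eqP; rewrite eqEfcard FH cF leqnn.
have ambA : ambiguous a.
  by move: (aH); rewrite -shF => /(shift_mem_notin aF)[da _]; rewrite shF; split; rewrite ?wF.
exists (tperm i j @: U), (tperm i j @: L).
have inj := @perm_inj _ (tperm i j).
have memE b : (rho b \in hfam k (tperm i j @: U) (tperm i j @: L)) = (b \in H).
  by rewrite !in_hfam wt_reflect0 supp_reflect0 hset_imset.
have eH : hfam k (tperm i j @: U) (tperm i j @: L) = [fset rho b | b in H].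
  apply/fsetP => b; apply/idP/imfsetP => [bH|[c /= cH ->]]; last by rewrite memE.
  by exists (rho b); rewrite ?reflect0K //= -memE reflect0K.
split; rewrite ?card_imset //; first exact: imsetS.
apply/eqP; rewrite eqEfcard eH card_imfset_vec ?cF ?leqnn ?andbT; last exact: can_inj reflect0K.
apply/fsubsetP => f fF'; rewrite -eH -[f]reflect0K memE.
have [fH|fH] := boolP (f \in H); last first.
  by move: fH; rewrite -shF => /(shift_mem_notin fF')[].
(* Here [rho f] turns out to be ambiguous, hence in [F] by uniformity, although an ambiguous vector
   and its reflection are never both in [F]. *)
apply: contraT => rH.
have ambR : ambiguous (rho f).
  split; rewrite ?wt_reflect0 ?wF ?reflect0K //.
  rewrite /shiftable reflect_i reflect_j // subn0 !addn0 ltnNge leq_eqVlt.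
  apply/negP => /orP[/eqP e|df].
    case/negP: rH; suff -> : rho f = f by [].
    apply: vecP => x; have [->|xi] := eqVneq x i; first by rewrite reflect_i addn0.
    have [->|xj] := eqVneq x j; first by rewrite reflect_j // subn0.
    by rewrite reflect_x.
  have df' : shiftable i j 0 f by rewrite /shiftable addn0.
  by move: fH rH; rewrite -shF => /(shift_shiftable_mem ij) /(_ df')[_ ->].
have := ambiguous_mem ambR; rewrite reflect0K fF' -(ambiguous_uniform ambA ambR).
by rewrite aF.
Qed.

End Swap.

(** * The structure of largest families *)

Section Permute.
Variable m : nat.
Implicit Types (a b : vec m) (F G : {fset vec m}) (s : {perm 'I_m}).

Definition permute s a : vec m := [ffun x => mu a (s x)].

Lemma mu_permute s a x : mu (permute s a) x = mu a (s x).
Proof. by rewrite [LHS]/mu ffunE. Qed.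

Lemma permuteK s : cancel (permute s) (permute s^-1%g).
Proof. by move=> a; apply: vecP => x; rewrite !mu_permute permKV. Qed.

Lemma wt_permute s a : wt (permute s a) = wt a.
Proof.
rewrite /wt [RHS](reindex_inj (@perm_inj _ s)); apply: eq_bigr => x _; exact: mu_permute.
Qed.

Lemma ov_permute s a b : ov (permute s a) (permute s b) = ov a b.
Proof.
rewrite /ov [RHS](reindex_inj (@perm_inj _ s)); apply: eq_bigr => x _.
by rewrite !mu_permute.
Qed.

Lemma card_permute s F : #|` [fset permute s a | a in F]| = #|` F|.
Proof. exact: card_imfset_vec (can_inj (permuteK s)). Qed.

Lemma fam_permute s k t F : fam k t F -> fam k t [fset permute s a | a in F].
Proof.
move=> /famP[wF oF nF]; apply/famP; split.
- by move=> _ /imfsetP[a /= aF ->]; rewrite wt_permute wF.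
- by move=> _ _ /imfsetP[a /= aF ->] /imfsetP[b /= bF ->]; rewrite ov_permute oF.
apply/ntrivP => T wT TF; apply: (ntrivP _ _ nF (permute s^-1%g T)); first by rewrite wt_permute.
move=> a aF x; rewrite mu_permute; have := TF (permute s a) _ (s^-1%g x).
by rewrite mu_permute permKV; apply; apply/imfsetP; exists a.
Qed.

Lemma maxfam_permute s k t F : maxfam k t F -> maxfam k t [fset permute s a | a in F].
Proof.
move=> [fF mF]; split; first exact: fam_permute.
by move=> G /(fam_permute s^-1%g) /mF; rewrite !card_permute.
Qed.

End Permute.

(** Raising [k], [t] and [#|L|] by one leaves all binomials of [card_hfam] unchanged and only turns
    the factor [t] into [t + 1]. *)
Lemma card_hfam_succ (m t k : nat) (U L U' L' : {set 'I_m}) :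
  k.+1 < m -> 0 < t ->
  U \subset L -> #|U| = t.+1 -> t.+1 + 2 <= #|L| -> #|L| <= k.+1 + 1 ->
  U' \subset L' -> #|U'| = t -> t + 2 <= #|L'| -> #|L'| <= k + 1 -> #|L| = #|L'|.+1 ->
  #|` hfam k U' L'| < #|` hfam k.+1 U L|.
Proof.
move=> km t0 UL cU tL Lk UL' cU' tL' Lk' LL.
have := card_hfam UL cU (ltn0Sn t) tL Lk; have := card_hfam UL' cU' t0 tL' Lk'.
rewrite LL.
have -> : m - #|L'|.+1 + k.+1 - 1 = m - #|L'| + k - 1 by lia.
have -> : m - t.+1 + k.+1 - 1 = m - t + k - 1 by lia.
have -> : k.+1 + 1 - #|L'|.+1 = k + 1 - #|L'| by lia.
rewrite subSS; have : 0 < 'C(m - #|L'| + k - 1, k + 1 - #|L'|) by rewrite bin_gt0; lia.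
by rewrite mulSn; lia.
Qed.

(** * Induction on t and on the energy *)

Section MainInduction.

Lemma shape_bounds (t k m : nat) : 0 < t -> t < k -> t * (k - t) + 2 < m -> k + 1 < m.
Proof.
move=> t0 tk hm; have [d kd] : exists d, k = t + d.+1 by exists (k - t.+1); lia.
move: hm; rewrite kd addKn; case: t t0 tk kd => // t _ _ _; nia.
Qed.

Lemma shape_bounds2 (t k m : nat) : 1 < t -> t < k -> t * (k - t) + 2 < m ->
  2 * k - t <= m /\ k < t * (m - k + t).
Proof.
move=> t1 tk hm; have [d kd] : exists d, k = t + d.+1 by exists (k - t.+1); lia.
have [s ts] : exists s, t = s.+2 by exists t.-2; lia.
have [u mu] : exists u, m = t * d.+1 + 3 + u by exists (m - (t * d.+1 + 3)); move: hm; rewrite kd addKn; lia.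
rewrite mu kd ts; split; first by nia.
have -> : s.+2 * d.+1 + 3 + u - (s.+2 + d.+1) + s.+2 = s.+1 * d.+1 + 3 + u by nia.
by nia.
Qed.

Lemma coreless_or m (F : {fset vec m}) :
  coreless F \/ exists x, {in F, forall a : vec m, 0 < mu a x}.
Proof.
have [/existsP[x /allP h]|] := boolP [exists x, all (fun a => 0 < mu a x) F].
  by right; exists x.
rewrite negb_exists => /forallP h; left=> x.
have /allPn[a aF] := h x; rewrite -leqNgt leqn0 => /eqP ax; by exists a.
Qed.

Lemma mu_ind m (x y : 'I_m) : mu (add_ind [set x] [ffun=> 0]) y = (y == x).
Proof. by rewrite mu_add_ind in_set1 /mu ffunE. Qed.

Lemma ntriv1_coreless m (F : {fset vec m}) : ntriv 1 F -> coreless F.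
Proof.
move=> /ntrivP nF; have [//|[x xF]] := coreless_or F; exfalso.
apply: (nF (add_ind [set x] [ffun=> 0])).
  rewrite wt_add_ind cards1 /wt big1 // => y _; by rewrite /mu ffunE.
by move=> a aF y; rewrite mu_ind; case: eqP => // ->; apply: xF.
Qed.

(** Only the size is recorded: for [t = 1] the compressions are not undone, and the induction on [t]
    asks for no more. *)
Definition hm_sized k t m (F : {fset vec m}) := exists U L : {set 'I_m},
  [/\ U \subset L, #|U| = t, t + 2 <= #|L| <= k + 1 & #|` F| = #|` hfam k U L|].

(** Deleting one copy of a common element gives a family for [(k, t)], no larger than some H(U',
    L'); by [card_hfam_succ] that is beaten by a family H(U, L) for [(k + 1, t + 1)]. *)
Lemma maxfam_coreless (t k m : nat) (F : {fset vec m}) : 0 < t -> t < k ->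
  t.+1 * (k - t) + 2 < m ->
  (forall G : {fset vec m}, maxfam k t G -> hm_sized k t G) ->
  maxfam k.+1 t.+1 F -> coreless F.
Proof.
move=> t0 tk hm IH mF; have [//|[x xF]] := coreless_or F; exfalso.
have [wF oF nF] := famP _ _ _ mF.1.
have sx a : a \in F -> [set x] \subset supp a by move=> aF; rewrite sub1set in_supp xF.
pose F1 := [fset sub_ind [set x] a | a in F].
have cF1 : #|` F1| = #|` F|.
  rewrite /F1 card_in_imfset //= => a b aF bF e.
  by rewrite -(sub_indK (sx a aF)) e sub_indK // sx.
have fF1 : fam k t F1.
  apply/famP; split.
  - by move=> _ /imfsetP[a /= aF ->]; rewrite wt_sub_ind ?sx // wF // cards1 subn1.
  - move=> _ _ /imfsetP[a /= aF ->] /imfsetP[b /= bF ->]; rewrite -ltnS.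
    apply: leq_trans (oF a b aF bF) _; rewrite /ov (bigD1 x) //= [\sum_y _](bigD1 x) //=.
    rewrite !mu_sub_ind !in_set1 eqxx -addSn leq_add //; first by move: (xF a aF) (xF b bF); clear; lia.
    apply: leq_sum => y yx; rewrite !mu_sub_ind !in_set1 (negPf yx) !subn0; exact: leqnn.
  apply/ntrivP => T wT TF; apply: (ntrivP _ _ nF (add_ind [set x] T)).
    by rewrite wt_add_ind cards1 wT addn1.
  move=> a aF y; rewrite mu_add_ind.
  have aF1 : sub_ind [set x] a \in F1 by apply/imfsetP; exists a.
  have := TF _ aF1 y; rewrite mu_sub_ind.
  rewrite in_set1; case: eqP => [->|_]; last by rewrite subn0 addn0.
  by move: (xF a aF); clear; lia.
have [G mG] := exists_maxfam fF1.
have [U' [L' [UL' cU' /andP[tL' Lk'] cG]]] := IH G mG.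
have km : k.+1 + 1 < m by apply: (@shape_bounds t.+1); rewrite ?subSS.
have lm : #|L'|.+1 <= m by move: Lk' km; clear; lia.
have tm : t.+1 <= m by move: tk km; clear; lia.
pose U := initial m t.+1; pose L := initial m #|L'|.+1.
have UL : U \subset L.
  apply/subsetP => y; rewrite !inE => yt; apply: leq_trans yt _.
  by rewrite ltnS; apply: leq_trans tL'; rewrite leq_addr.
have cU : #|U| = t.+1 by apply: card_initial.
have cL : #|L| = #|L'|.+1 by apply: card_initial.
have tL : t.+1 + 2 <= #|L| by rewrite cL addSn ltnS.
have Lk : #|L| <= k.+1 + 1 by rewrite cL addSn ltnS.
have fH := hfam_fam UL cU (ltn0Sn t) tL Lk.
have := mF.2 _ fH; rewrite leqNgt => /negP[].
rewrite -cF1; apply: leq_ltn_trans (mG.2 _ fF1) _; rewrite cG.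
apply: (@card_hfam_succ m t k) => //.
by move: km; clear; lia.
Qed.

(** A swap may spoil the balance reached before; this is harmless, because the energy still drops
    and the induction hypothesis covers every largest family of smaller energy. *)
Lemma maxfam_hfam_large (t k m : nat) (F : {fset vec m}) : 1 < t -> t < k ->
  t * (k - t) + 2 < m ->
  (forall G : {fset vec m}, maxfam k t G -> coreless G) -> maxfam k t F ->
  exists U L : {set 'I_m}, [/\ U \subset L, #|U| = t, t + 2 <= #|L| <= k + 1 & F = hfam k U L].
Proof.
move=> t1 tk hm core; have t0 := ltnW t1.
have [kt2 ktm] := shape_bounds2 t1 tk hm.
have km : k < m by have := shape_bounds t0 tk hm; clear; lia.
move: {2}_.+1 (ltnSn (energy F)) => n; elim: n F => // n IHn F eF mF.
have fF := mF.1; have cF := core F mF.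
have [/forallP bal|] := boolP [forall i, forall j, (i != j) ==> (shift i j 1 F == F)]; last first.
  rewrite negb_forall => /existsP[i0]; rewrite negb_forall => /existsP[j0].
  rewrite negb_imply => /andP[ij0 sF0].
  have [i [j [ij sF nS]]] := exists_nontrivial_balancing fF cF t1 km ktm ij0 sF0.
  have mS := shift_maxfam ij mF nS.
  have eS : energy (shift i j 1 F) < n by apply: (@leq_trans (energy F)); first exact: energy_shift.
  have [U [L [UL cU /andP[tL Lk] SH]]] := IHn _ eS mS.
  have FH := unbalance_hfam UL cU t0 tL Lk fF ij SH.
  by exists U, L; split; rewrite ?tL.
have {}bal : balanced F by move=> i j ij; have /forallP/(_ j) := bal i; rewrite ij => /eqP.
have suppF := balanced_supp fF kt2 bal.
have [/forallP stab|] := boolP [forall i : 'I_m, forall j : 'I_m, (j < i) ==> (shift i j 0 F == F)].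
  apply: compressed_structure => // i j ji _.
  by have /forallP/(_ j) := stab i; rewrite ji => /eqP.
rewrite negb_forall => /existsP[i]; rewrite negb_forall => /existsP[j].
rewrite negb_imply => /andP[ji sF].
have ij : i != j by apply: contraTneq ji => ->; rewrite ltnn.
have mS := shift_maxfam ij mF (balanced_swap_ntriv fF cF t1 km bal ij).
have eS : energy (shift i j 0 F) < n by apply: (@leq_trans (energy F)); first exact: energy_shift.
have [U [L [UL cU /andP[tL Lk] SH]]] := IHn _ eS mS.
have [U' [L' [UL' cU' cL' FH]]] := swap_hfam UL cU t0 tL Lk fF ij SH.
by exists U', L'; split; rewrite ?cL' ?tL.
Qed.

(** * The base case t = 1 *)

Section Intersecting.
Variables (k m : nat).
Hypotheses (k1 : 1 < k) (hm : 1 * (k - 1) + 2 < m).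
Implicit Types (F : {fset vec m}) (a b : vec m).

Lemma intersecting_supp F : fam k 1 F -> {in F &, forall a b : vec m, 1 <= #|supp a :&: supp b|}.
Proof.
by move=> /famP[_ oF _] a b aF bF; rewrite card_gt0 -ov_gt0 oF.
Qed.

(** By maximality every vector containing both points is a member. One supported on just these two
    shows that swaps among the other points keep the family non-trivial, while swaps into either of
    the two points fix the family. *)
Lemma maxfam_hit_pair F (o0 o1 : 'I_m) : nat_of_ord o0 = 0 -> nat_of_ord o1 = 1 ->
  maxfam k 1 F -> {in F, forall a : vec m, 0 < mu a o0 \/ 0 < mu a o1} -> hm_sized k 1 F.
Proof.
move=> o00 o11; move: {2}_.+1 (ltnSn (energy F)) => n; elim: n F => // n IHn F eF mF hF.
have fF := mF.1; have [wF oF nF] := famP _ _ _ fF; have cF := ntriv1_coreless nF.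
have closed b : wt b = k -> (forall a, a \in F -> exists2 x, 0 < mu b x & 0 < mu a x) -> b \in F.
  move=> wb hb; apply: (maxfam_closed mF (ltnW k1) wb) => a aF.
  have [x bx ax] := hb a aF; rewrite ov_gt0; apply/set0Pn; exists x.
  by rewrite in_setI !in_supp bx ax.
have both b : wt b = k -> 0 < mu b o0 -> 0 < mu b o1 -> b \in F.
  by move=> wb b0 b1; apply: closed => // a /hF[]; [exists o0|exists o1].
have [/forallP stab|] := boolP [forall i : 'I_m, forall j : 'I_m,
    (j < i) && (1 < i) ==> (shift i j 0 F == F)].
  have [|U [L [UL cU tL FH]]] := compressed_structure (ltn0Sn 0) k1 hm mF cF (intersecting_supp fF).
    by move=> i j ji i1; have /forallP/(_ j) := stab i; rewrite ji i1 => /eqP.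
  by exists U, L; split; rewrite // {1}FH.
rewrite negb_forall => /existsP[i]; rewrite negb_forall => /existsP[j].
rewrite negb_imply => /andP[/andP[ji i1] sF].
have ij : i != j by apply: contraTneq ji => ->; rewrite ltnn.
have i0 : o0 != i by apply: contraTneq i1 => <-; rewrite o00.
have i01 : o1 != i by apply: contraTneq i1 => <-; rewrite o11.
have [j1|j1] := ltnP 1 j; last first.
  case/eqP: sF; apply/eqP; rewrite eq_sym eqEfcard card_shift // leqnn andbT.
  apply/fsubsetP => a aF; apply: contraT => /(shift_mem_notin aF)[da /negP nr _]; case: nr.
  have wr : wt (reflect_vec i j 0 a) = k by rewrite wt_reflect // wF.
  have ai : 0 < mu a i by apply: leq_ltn_trans da.
  have rj : mu (reflect_vec i j 0 a) j = mu a i by rewrite reflect_j // subn0.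
  have [aj|aj] := posnP (mu a j); last first.
    apply: closed => // c cF0; have : 0 < ov a c by apply: oF.
    rewrite ov_gt0 => /set0Pn[x]; rewrite in_setI !in_supp => /andP[ax cx].
    exists x => //; have [->|xi] := eqVneq x i; first by rewrite reflect_i addn0.
    by have [->|xj] := eqVneq x j; rewrite ?rj // reflect_x.
  have [jo|jo] : j = o0 \/ j = o1.
    case: (posnP j) => j0; [left|right]; apply: val_inj; rewrite /= ?o00 ?o11 //.
    by apply/eqP; rewrite eqn_leq j1.
  - case: (hF a aF) => [a0|a1]; first by rewrite -jo aj in a0.
    apply: both => //; first by rewrite -jo rj.
    by rewrite reflect_x // jo -val_eqE /= o00 o11.
  case: (hF a aF) => [a0|a1]; last by rewrite -jo aj in a1.
  apply: both => //; last by rewrite -jo rj.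
  by rewrite reflect_x // jo -val_eqE /= o00 o11.
have j0 : o0 != j by apply: contraTneq j1 => <-; rewrite o00.
have j01 : o1 != j by apply: contraTneq j1 => <-; rewrite o11.
have nS : ntriv 1 (shift i j 0 F).
  apply: contraT => /(shift_trivial fF cF ij (leq0n _)) h.
  have o01 : o1 != o0 by apply/eqP => /(congr1 val) /=; rewrite o00 o11.
  pose c := padded k [set o0; o1] o0.
  have sc : supp c = [set o0; o1] by rewrite supp_padded // !inE eqxx.
  have cc : c \in F.
    apply: both; rewrite -?in_supp ?sc ?in_set2 ?eqxx ?orbT //.
    by rewrite wt_padded // cards2; case: (o0 != o1) => //; apply: ltnW.
  by case: (h c cc); rewrite ?addn0 -in_supp sc in_set2 eq_sym (negPf j0, negPf i0) eq_sym (negPf j01, negPf i01).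
have eS : energy (shift i j 0 F) < n by apply: (@leq_trans (energy F)); first exact: energy_shift.
have [|U [L [UL cU tL FH]]] := IHn _ eS (shift_maxfam ij mF nS).
  move=> _ /imfsetP[a /= aF ->]; case: (shift1P i j 0 F a) => [[_ [_ ->]]|[-> _]]; last exact: hF.
  by rewrite !reflect_x //; apply: hF.
by exists U, L; split; rewrite // -FH card_shift.
Qed.

Lemma maxfam_hm_sized1 F : maxfam k 1 F -> hm_sized k 1 F.
Proof.
move: {2}_.+1 (ltnSn (energy F)) => n; elim: n F => // n IHn F eF mF.
have fF := mF.1; have [wF oF nF] := famP _ _ _ fF; have cF := ntriv1_coreless nF.
have [/forallP stab|] := boolP [forall i : 'I_m, forall j : 'I_m, (j < i) ==> (shift i j 0 F == F)].
  have [|U [L [UL cU tL FH]]] := compressed_structure (ltn0Sn 0) k1 hm mF cF (intersecting_supp fF).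
    by move=> i j ji _; have /forallP/(_ j) := stab i; rewrite ji => /eqP.
  by exists U, L; split; rewrite // {1}FH.
rewrite negb_forall => /existsP[i]; rewrite negb_forall => /existsP[j].
rewrite negb_imply => /andP[ji sF].
have ij : i != j by apply: contraTneq ji => ->; rewrite ltnn.
have [nS|/(shift_trivial fF cF ij (leq0n _)) h] := boolP (ntriv 1 (shift i j 0 F)).
  have eS : energy (shift i j 0 F) < n by apply: (@leq_trans (energy F)); first exact: energy_shift.
  have [U [L [UL cU tL FH]]] := IHn _ eS (shift_maxfam ij mF nS).
  by exists U, L; split; rewrite // -FH card_shift.
have m1 : 1 < m by move: hm; clear; lia.
pose o0 := Ordinal (ltnW m1); pose o1 := Ordinal m1.
pose s1 := tperm o0 j; pose s := (s1 * tperm (s1 o1) i)%g.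
have s0 : s o0 = j.
  rewrite permM /s1 tpermL tpermD //.
  by rewrite -[X in _ != X](tpermL o0 j) (inj_eq perm_inj).
have s11 : s o1 = i by rewrite permM tpermL.
have [|U [L [UL cU tL FH]]] := @maxfam_hit_pair _ o0 o1 erefl erefl (maxfam_permute s mF).
  move=> _ /imfsetP[a /= aF ->]; rewrite !mu_permute s0 s11.
  by case: (h a aF); rewrite ?addn0; [left|right].
by exists U, L; split; rewrite // -FH card_permute.
Qed.

End Intersecting.

Lemma maxfam_hm_sized (t k m : nat) (F : {fset vec m}) : 0 < t -> t < k ->
  t * (k - t) + 2 < m -> maxfam k t F -> hm_sized k t F.
Proof.
elim: t k F => // -[|t] IHt k F _ tk hm mF; first exact: maxfam_hm_sized1.
case: k tk hm mF => // k tk hm mF; rewrite subSS in hm.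
have [] // := @maxfam_hfam_large t.+2 k.+1 m F.
  move=> G mG; apply: (@maxfam_coreless t.+1 k) mG => // G' mG'; apply: IHt => //.
  by apply: leq_ltn_trans hm; rewrite leq_add2r leq_mul2r leqnSn orbT.
by move=> U [L [UL cU tL FH]]; exists U, L; split; rewrite // {1}FH.
Qed.

Lemma maxfam_hfam (t k m : nat) (F : {fset vec m}) : 1 < t -> t < k ->
  t * (k - t) + 2 < m -> maxfam k t F ->
  exists U L : {set 'I_m}, [/\ U \subset L, #|U| = t, t + 2 <= #|L| <= k + 1 & F = hfam k U L].
Proof.
move=> t1 tk hm mF; apply: maxfam_hfam_large => // G mG.
case: t t1 tk hm mF mG => // t t1 tk; case: k tk => // k tk; rewrite subSS => hm _ mG.
apply: (@maxfam_coreless t k) mG => // G' mG'; apply: maxfam_hm_sized => //.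
by apply: leq_ltn_trans hm; rewrite leq_add2r leq_mul2r leqnSn orbT.
Qed.

End MainInduction.

(** * Sizes of the families H(U, L) *)

(* Iteration of (x + a)(x - c) <= (x - a)(x - c + 2a), with x = y + c. *)
Lemma ffact_weak j y c : j * j.+1 <= c ->
  y * (y + c + j) ^_ j <= (y + j * j.+1) * (y + c).-1 ^_ j.
Proof.
elim: j y c => [|j IHj] y c hc; first by rewrite !ffactn0 mul0n addn0.
have [e ce] : exists e, c = e + j.+1 by exists (c - j.+1); move: hc; nia.
have he : j * j.+1 <= c - 2 * j.+1 by nia.
have := IHj (y + 2 * j.+1) _ he.
have -> : y + 2 * j.+1 + (c - 2 * j.+1) = y + c by nia.
rewrite addnS ffactSS ffactnSr => IH.
have -> : (y + c).-1 - j = y + e by lia.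
apply: (@leq_trans ((y + e) * (y + 2 * j.+1) * (y + c + j) ^_ j)).
  by rewrite mulnA leq_mul2r; apply/orP; right; rewrite ce; nia.
rewrite -mulnA; apply: leq_trans (leq_mul (leqnn (y + e)) IH) _.
have -> : y + j.+1 * j.+2 = y + 2 * j.+1 + j * j.+1 by nia.
by rewrite mulnCA [(y + e) * _]mulnC.
Qed.

Lemma ffact_ge_fact x j : 2 <= x -> j.+2`! <= 2 * (x + j) ^_ j.
Proof.
move=> x2; elim: j => [|j IHj]; first by rewrite ffactn0.
rewrite factS addnS ffactSS mulnCA; apply: leq_mul => //; lia.
Qed.

(** For [x = m - 2] and [d = k - t] this compares the sizes of the tilde family and of F_(1) after
    cancelling their common term. *)
Lemma bin_star_lt (x t d : nat) : 2 <= d -> d <= t.+1 -> 1 < t -> t * d < x ->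
  t + 'C(x + d - 1, d) < 'C(x, d) + t * 'C(x + d - 1, d - 1).
Proof.
case: d => [|[|j]] // _ dt t1 hx.
rewrite -(@ltn_pmul2r j.+2`!) ?fact_gt0 // !mulnDl -!mulnA !bin_ffact.
rewrite (_ : x + j.+2 - 1 = (x + j).+1); last by lia.
rewrite (_ : j.+2 - 1 = j.+1); last by lia.
rewrite (_ : 'C((x + j).+1, j.+1) * j.+2`! = j.+2 * ((x + j).+1 ^_ j.+1)); last first.
  by rewrite -bin_ffact factS mulnCA.
rewrite ffactnSr (_ : (x + j).+1 - j.+1 = x); last by lia.
rewrite ffactSS ffactnS.
set R := (x + j) ^_ j; set S := x.-1 ^_ j.+1.
(* This is where [d <= t + 1] enters: with [d = j + 2] it says
   [(j + 1) * (j + 2) <= t * (j + 2)]. *)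
have hc : j * j.+1 <= t * j.+2 - 2 * j.+1 by nia.
have [y xy] : exists y, x = y + t * j.+2 by exists (x - t * j.+2); lia.
have := ffact_weak (y + 2 * j.+1) hc.
have -> : y + 2 * j.+1 + (t * j.+2 - 2 * j.+1) = x by nia.
rewrite -/R => hw.
have hS : S = x.-1 ^_ j * (x - j.+1) by rewrite /S ffactnSr; congr (_ * _); lia.
have hR : j.+2`! <= 2 * R by apply: ffact_ge_fact; nia.
have [e he] : exists e, t * j.+2 = e + j.+1 by exists (t * j.+2 - j.+1); nia.
have xj : x - j.+1 = y + e by lia.
have xS : (y + 2 * j.+1) * R * (y + e) <= x * S.
  rewrite hS xj mulnA leq_mul2r; apply/orP; right.
  apply: leq_trans hw _; rewrite leq_mul2r; apply/orP; right.
  by rewrite xy; nia.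
have et : t < j.+1 * e by nia.
have f0 : 0 < j.+2`! by apply: fact_gt0.
clear hw hS; move: hR f0 xS; move: (j.+2`!) R S => f R' S' hR f0 xS.
have gap : t * f < 2 * j.+1 * e * R'.
  apply: (@leq_trans (j.+1 * e * f)); first by rewrite ltn_pmul2r.
  rewrite (_ : 2 * j.+1 * e * R' = j.+1 * e * (2 * R')); first by rewrite leq_mul2l hR orbT.
  by rewrite mulnCA !mulnA.
apply: leq_trans (leq_add xS (leqnn _)).
rewrite -addSn (leq_trans (leq_add gap (leqnn _))) //.
rewrite (_ : t * (j.+2 * ((x + j).+1 * R')) = (e + j.+1) * ((x + j).+1 * R')); last first.
  by rewrite mulnA he.
have -> : x = y + (e + j.+1) by rewrite -he.
by apply/eq_leq; clear; nia.
Qed.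

Definition hm_size m t k l :=
  'C(m - t + k - 1, k - t) + t * 'C(m - l + k - 1, k + 1 - l) - 'C(m - l + k - 1, k - t).

Section Sizes.
Variables (m t k : nat).
Hypotheses (t1 : 1 < t) (tk : t < k) (hm : t * (k - t) + 2 < m).
Local Notation d := (k - t).
(** The index [q = #|L| - t - 1] runs from 1, for F_(1), to [d], for the tilde family. *)
Local Notation W q := (hm_size m t k (t + 1 + q)).

Let dm : d + t + 1 < m. Proof. by rewrite subnK ?(ltnW tk) //; apply: shape_bounds hm => //; apply: ltnW. Qed.

Lemma hm_sizeE q : 0 < q <= d -> W q + 'C(m + d - 2 - q, d) =
  'C(m - t + k - 1, d) + t * 'C(m + d - 2 - q, d - q).
Proof.
move=> /andP[q0 qd]; rewrite /hm_size.
have -> : m - (t + 1 + q) + k - 1 = m + d - 2 - q by lia.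
have -> : k + 1 - (t + 1 + q) = d - q by lia.
rewrite subnK //; apply: leq_trans (leq_addr _ _); apply: leq_bin2l; lia.
Qed.

Lemma hm_size_step q : 0 < q < d ->
  W q.+1 + t * 'C(m + d - 3 - q, d - q) = W q + 'C(m + d - 3 - q, d - 1).
Proof.
move=> /andP[q0 qd].
have e1 : W q.+1 + 'C(m + d - 2 - q.+1, d) =
  'C(m - t + k - 1, d) + t * 'C(m + d - 2 - q.+1, d - q.+1).
  by apply: hm_sizeE; rewrite qd.
have e2 : W q + 'C(m + d - 2 - q, d) = 'C(m - t + k - 1, d) + t * 'C(m + d - 2 - q, d - q).
  by apply: hm_sizeE; rewrite q0 ltnW.
have eM : m + d - 2 - q = (m + d - 3 - q).+1 by lia.
have eM' : m + d - 2 - q.+1 = m + d - 3 - q by lia.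
have ed : d = (d - 1).+1 by lia.
have eq1 : d - q = (d - q.+1).+1 by lia.
have b1 : 'C(m + d - 2 - q, d) = 'C(m + d - 3 - q, d) + 'C(m + d - 3 - q, d - 1).
  by rewrite eM; move: (m + d - 3 - q) => M; rewrite {1 2}ed binS.
have b2 : 'C(m + d - 2 - q, d - q) = 'C(m + d - 3 - q, d - q) + 'C(m + d - 3 - q, d - q.+1).
  by rewrite eM; move: (m + d - 3 - q) => M; rewrite eq1 binS.
rewrite eM' in e1; rewrite b1 b2 mulnDr in e2.
move: e1 e2; clear; lia.
Qed.

Definition rising q := t * 'C(m + d - 3 - q, d - q) < 'C(m + d - 3 - q, d - 1).

(** Passing to [q + 1] scales the two binomials by [(d - q) / M] and [(M - d + 1) / M] with
    [M = m + d - 3 - q]; the second factor is no smaller, so a rise persists. *)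
Lemma rising_succ q : 0 < q -> q.+1 < d -> rising q -> rising q.+1.
Proof.
move=> q0 qd; rewrite /rising.
have -> : m + d - 3 - q.+1 = (m + d - 3 - q).-1 by lia.
have M0 : 0 < m + d - 3 - q by lia.
have Md : d - q <= m + d - 3 - q - (d - 1) by lia.
have eq1 : d - q = (d - q.+1).+1 by lia.
move: M0 Md; move: (m + d - 3 - q) => M M0 Md rise.
rewrite -(@ltn_pmul2l M) // mulnCA mul_bin_diag mul_bin_down -eq1.
apply: (@leq_trans ((d - q) * 'C(M, d - 1))); last by rewrite leq_mul2r Md orbT.
by rewrite mulnCA ltn_pmul2l // subn_gt0 ltnW.
Qed.

Lemma rising_lt q r : 0 < q -> q + r < d -> rising q -> W q < W (q + r.+1).
Proof.
move=> q0; elim: r => [|r IHr] qr rq.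
  rewrite addn0 in qr; rewrite [q + 1]addn1; have := hm_size_step (q := q); rewrite q0 qr => /(_ isT).
  by move: rq; rewrite /rising; clear; lia.
have {IHr} := IHr (ltnW _); rewrite -addnS => /(_ qr rq) h; apply: (ltn_trans h).
have rr : rising (q + r.+1).
  elim: (r.+1) qr => [|s IHs] qs; first by rewrite addn0.
  rewrite addnS in qs *; apply: rising_succ qs (IHs (ltnW qs)); by rewrite addn_gt0 q0.
have := hm_size_step (q := q + r.+1); rewrite addn_gt0 q0 qr -addnS => /(_ isT).
by move: rr; rewrite /rising; clear; lia.
Qed.

Lemma falling_lt q : 1 < q <= d -> ~~ rising q.-1 -> W q < W 1.
Proof.
case: q => // q /andP[]; rewrite ltnS; case: q => // q _ qd /= nr.
elim: q qd nr => [|q IHq] qd nr.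
  (* At [q = 1] both binomials agree and [t > 1], so the first step falls strictly. *)
  have := hm_size_step (q := 1); rewrite qd => /(_ isT).
  have c0 : 0 < 'C(m + d - 3 - 1, d - 1) by rewrite bin_gt0; lia.
  move=> e; rewrite -(ltn_add2r (t * 'C(m + d - 3 - 1, d - 1))) e ltn_add2l.
  by rewrite -{1}['C(_, _)]mul1n ltn_pmul2r.
have nr' : ~~ rising q.+1.
  by apply: contra nr; apply: rising_succ.
have := hm_size_step (q := q.+2); rewrite qd => /(_ isT).
have := IHq (ltnW qd) nr'; move: nr; rewrite /rising; clear; lia.
Qed.

Lemma hm_size_interior l : t + 2 < l -> l < k + 1 ->
  hm_size m t k l < maxn (hm_size m t k (t + 2)) (hm_size m t k (k + 1)).
Proof.
move=> tl lk; have [q lq] : exists q, l = t + 1 + q by exists (l - (t + 1)); lia.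
have -> : t + 2 = t + 1 + 1 by lia.
have -> : k + 1 = t + 1 + d by lia.
rewrite leq_max lq; have [r|r] := boolP (rising q); apply/orP; [right|left].
  have -> : d = q + (d - q - 1).+1 by lia.
  apply: rising_lt r; lia.
apply: falling_lt; first by lia.
apply: contra r; rewrite -{2}[q]prednK; last by lia.
by apply: rising_succ; lia.
Qed.

Lemma hm_size_small : t + 1 < k -> k <= 2 * t + 1 ->
  hm_size m t k (k + 1) < hm_size m t k (t + 2).
Proof.
move=> tk1 kt; have -> : t + 2 = t + 1 + 1 by lia.
have -> : k + 1 = t + 1 + d by lia.
have [e1 e2] : W d + 'C(m + d - 2 - d, d) = 'C(m - t + k - 1, d) + t * 'C(m + d - 2 - d, d - d)
  /\ W 1 + 'C(m + d - 2 - 1, d) = 'C(m - t + k - 1, d) + t * 'C(m + d - 2 - 1, d - 1).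
  by split; apply: hm_sizeE; lia.
have [] : m + d - 2 - d = m - 2 /\ m + d - 2 - 1 = (m - 2) + d - 1 by lia.
move=> em1 em2; rewrite em1 subnn bin0 muln1 in e1; rewrite em2 in e2.
have := @bin_star_lt (m - 2) t d; move: e1 e2 hm t1 tk1 kt; lia.
Qed.

End Sizes.

Lemma card_hfamE m t k (U L : {set 'I_m}) : U \subset L -> #|U| = t -> 0 < t ->
  t + 2 <= #|L| -> #|L| <= k + 1 -> #|` hfam k U L| = hm_size m t k #|L|.
Proof. by move=> UL cU t0 tL Lk; rewrite /hm_size -(card_hfam UL cU t0 tL Lk) addnK. Qed.

(** * From vectors to multisets *)

Lemma exists_perm_imset (T : finType) (U L U' L' : {set T}) :
  U \subset L -> U' \subset L' -> #|U| = #|U'| -> #|L| = #|L'| ->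
  exists s : {perm T}, s @: U = U' /\ s @: L = L'.
Proof.
move=> UL UL' cU cL.
(* Listing the inner set, then the rest of the outer set, then the complement, the permutation
   matches positions. *)
pose e (A B : {set T}) := enum A ++ (enum (B :\: A) ++ enum (~: B)).
have in_e (A B : {set T}) x : A \subset B -> x \in e A B.
  move=> AB; rewrite !mem_cat !mem_enum in_setD in_setC.
  by case: (x \in A); case: (x \in B).
have uniq_e (A B : {set T}) : A \subset B -> uniq (e A B).
  move=> AB; rewrite !cat_uniq !enum_uniq /= andbT; apply/andP; split; apply/hasPn => x.
    rewrite mem_cat !mem_enum in_setD in_setC => /orP[/andP[]//|].
    by apply: contra; apply: (subsetP AB).
  by rewrite !mem_enum in_setD in_setC; case: (x \in B); rewrite ?andbF.
have size_e (A B : {set T}) : A \subset B -> size (e A B) = #|T|.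
  move=> AB; rewrite -(card_uniqP (uniq_e A B AB)); apply: eq_card => x.
  by rewrite in_e.
pose f x := nth x (e U' L') (index x (e U L)).
have lt_e x : index x (e U L) < size (e U' L').
  by rewrite size_e // -(size_e U L) // index_mem in_e.
have f_inj : injective f.
  move=> x y; rewrite /f (set_nth_default y) // => /eqP.
  rewrite nth_uniq ?uniq_e // => /eqP ixy.
  by rewrite -(nth_index x (in_e U L x UL)) ixy nth_index ?in_e.
exists (perm f_inj); split; apply/eqP; rewrite eqEcard card_imset ?cU ?cL ?leqnn ?andbT;
  try exact: perm_inj; apply/subsetP => _ /imsetP[x xA ->]; rewrite permE /f.
  have xi : index x (e U L) < #|U'|.
    by rewrite -cU cardE /e index_cat mem_enum xA index_mem mem_enum.
  by rewrite /e nth_cat -cardE xi -mem_enum mem_nth // -cardE.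
have xi : index x (e U L) < #|L'|.
  have -> : #|L'| = size (enum U ++ enum (L :\: U)).
    by rewrite size_cat -!cardE cardsDS // subnKC // -?cL // subset_leq_card.
  rewrite /e catA index_cat mem_cat !mem_enum in_setD xA andbT orbN index_mem mem_cat !mem_enum.
  by rewrite in_setD xA andbT orbN.
have sz : size (enum U' ++ enum (L' :\: U')) = #|L'|.
  by rewrite size_cat -!cardE cardsDS // subnKC // subset_leq_card.
have : nth x (e U' L') (index x (e U L)) \in enum U' ++ enum (L' :\: U').
  by rewrite /e catA nth_cat sz xi mem_nth // sz.
rewrite mem_cat !mem_enum in_setD => /orP[/(subsetP UL')//|/andP[_ //]].
Qed.

Section Transfer.
Variable m : nat.
Implicit Types (A B : {mset 'I_m}) (a b : vec m) (F : {fset {mset 'I_m}}) (U L S : {set 'I_m}).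

Definition vec_of A : vec m := [ffun x => A x].

Lemma mu_vec_of A x : mu (vec_of A) x = A x.
Proof. by rewrite /mu ffunE. Qed.

Lemma vec_of_inj : injective vec_of.
Proof. by move=> A B e; apply/msetP => x; rewrite -!mu_vec_of e. Qed.

Definition mset_of a : {mset 'I_m} := seq_mset (flatten [seq nseq (mu a x) x | x <- enum 'I_m]).

Lemma mset_ofE a x : mset_of a x = mu a x.
Proof.
rewrite mset_seqE count_flatten -map_comp sumnE big_map big_enum /=.
rewrite (bigD1 x) //= count_nseq /= eqxx mul1n big1 ?addn0 // => y yx.
by rewrite count_nseq /= (negPf yx).
Qed.

Lemma mset_ofK : cancel mset_of vec_of.
Proof. by move=> a; apply: vecP => x; rewrite mu_vec_of mset_ofE. Qed.

Lemma size_wt A : size A = wt (vec_of A).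
Proof.
transitivity (\sum_x count_mem x A); last first.
  by apply: eq_bigr => x _; rewrite mu_vec_of count_mem_mset.
elim: (A : seq _) => [|y s IHs] /=; first by rewrite big1.
rewrite big_split /= -IHs (bigD1 y) //= eqxx big1 ?addn0 ?add1n // => x xy.
by rewrite eq_sym (negPf xy).
Qed.

Lemma size_msetI A B : size (A `&` B)%mset = ov (vec_of A) (vec_of B).
Proof.
rewrite size_wt; apply: eq_bigr => x _.
by rewrite !mu_vec_of msetE2.
Qed.

Lemma mset_of_setE S x : mset_of_set S x = (x \in S).
Proof. by rewrite /mset_of_set mset_seqE count_uniq_mem ?enum_uniq // mem_enum. Qed.

Definition vecs F : {fset vec m} := [fset vec_of A | A in F].

Lemma card_vecs F : #|` vecs F| = #|` F|.
Proof. by rewrite /vecs card_imfset //; apply: vec_of_inj. Qed.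

Lemma vecs_fam k t F : {in F, forall A : {mset 'I_m}, size A = k} -> t_intersecting t F ->
  size (mset_bigcap F) < t -> F != fset0 -> fam k t (vecs F).
Proof.
move=> sF iF capF F0; apply/famP; split.
- by move=> _ /imfsetP[A /= AF ->]; rewrite -size_wt sF.
- by move=> _ _ /imfsetP[A /= AF ->] /imfsetP[B /= BF ->]; rewrite -size_msetI iF.
apply/ntrivP => T wT TF; move: capF; rewrite ltnNge => /negP[].
have : (mset_of T `<=` mset_bigcap F)%mset.
  apply/(mset_bigcapP _ F0) => A AF; apply/msubsetP => x.
  by rewrite mset_ofE -mu_vec_of TF //; apply/imfsetP; exists A.
move=> /msubsetP le; rewrite size_wt -wT; apply: leq_sum => x _.
by rewrite mu_vec_of -mset_ofE.
Qed.

Definition hm_msets k U L : {fset {mset 'I_m}} :=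
  [fset A in kmultisets m k | hset U L (supp (vec_of A))].

Lemma in_hm_msets k U L A : (A \in hm_msets k U L) = (vec_of A \in hfam k U L).
Proof. by rewrite 2!inE /= in_kmultisets in_hfam size_wt. Qed.

Lemma vecs_hm_msets k U L : vecs (hm_msets k U L) = hfam k U L.
Proof.
apply/fsetP => a; apply/imfsetP/idP => [[A /= AH ->]|aH]; first by rewrite -in_hm_msets.
by exists (mset_of a); rewrite ?mset_ofK //= in_hm_msets mset_ofK.
Qed.

Lemma vecs_inj : injective vecs.
Proof.
have mem A F : (vec_of A \in vecs F) = (A \in F) by rewrite mem_imfset //; apply: vec_of_inj.
by move=> F G e; apply/fsetP => A; rewrite -!mem e.
Qed.

Lemma itv1E n : itv m 1 n = initial m n.
Proof. by apply/setP => x; rewrite !inE. Qed.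

Lemma mset_permE (s : {perm 'I_m}) A x : mset_perm s A x = A (s^-1%g x).
Proof.
rewrite /mset_perm mset_seqE count_map -count_mem_mset; apply: eq_count => y /=.
by rewrite -{1}(permKV s x) (inj_eq perm_inj).
Qed.

Lemma vec_of_perm (s : {perm 'I_m}) A : vec_of (mset_perm s A) = permute s^-1%g (vec_of A).
Proof. by apply: vecP => x; rewrite mu_permute !mu_vec_of mset_permE. Qed.

Lemma isomorphic_card F G : isomorphic F G -> #|` F| = #|` G|.
Proof.
case=> s ->; rewrite card_imfset //= => A B e; apply: vec_of_inj.
by apply: (can_inj (permuteK s^-1%g)); rewrite -!vec_of_perm e.
Qed.

Lemma supp_permute (s : {perm 'I_m}) a : supp (permute s^-1%g a) = s @: supp a.
Proof.
apply/setP => x; rewrite -{2}(permKV s x) mem_imset; last exact: perm_inj.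
by rewrite !in_supp mu_permute.
Qed.

Lemma hm_msets_isomorphic k U L U' L' : U \subset L -> U' \subset L' ->
  #|U| = #|U'| -> #|L| = #|L'| -> isomorphic (hm_msets k U L) (hm_msets k U' L').
Proof.
move=> UL UL' cU cL; have [s [sU sL]] := exists_perm_imset UL UL' cU cL.
have memE A : (mset_perm s A \in hm_msets k U' L') = (A \in hm_msets k U L).
  by rewrite !in_hm_msets vec_of_perm !in_hfam wt_permute supp_permute -sU -sL hset_imset.
exists s; apply/fsetP => B; apply/idP/imfsetP => [BH|[A /= AH ->]]; last by rewrite memE.
have eB : B = mset_perm s (mset_perm s^-1%g B).
  by apply/msetP => x; rewrite !mset_permE invgK permKV.
by exists (mset_perm s^-1%g B); rewrite // -memE -eB.
Qed.

(** Holding [t + 1] of the [t + 2] points of [L] means missing at most one: a miss in [U] leaves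
    some [L :\ y], otherwise [U] and a further point are present. *)
Lemma F1E k t : t + 2 <= m -> F1 m k t = hm_msets k (initial m t) (initial m (t + 2)).
Proof.
move=> tm; have tm' : t <= m := leq_trans (leq_addr _ _) tm.
apply/fsetP => A; rewrite /F1 /hm_msets !inE /= itv1E.
rewrite /F1 /hm_msets; congr (_ && _).
set L := initial m (t + 2); set U := initial m t; set S := supp (vec_of A).
have cL : #|L| = t + 2 by apply: card_initial.
have cU : #|U| = t by apply: card_initial.
have UL : U \subset L.
  by apply/subsetP => x; rewrite !inE => /leq_trans; apply; rewrite leq_addr.
have -> : size (A `&` mset_of_set L)%mset = #|S :&: L|.
  rewrite size_msetI -sum1_card /ov [RHS]big_mkcond; apply: eq_bigr => x _.
  rewrite mu_vec_of [mu _ x]mu_vec_of mset_of_setE in_setI in_supp mu_vec_of.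
  by case: (x \in L); rewrite ?minn0 ?andbF // andbT; case: (A x).
have cLS := cardsID S L; rewrite setIC in cLS.
apply/idP/(hsetP) => [h|].
  have [|/subsetPn[y yU yS]] := boolP (U \subset S).
    move=> US; left; split=> //.
    have /subsetPn[z] : ~~ (S :&: L \subset U).
      by apply/negP => /subset_leq_card; rewrite cU leqNgt -addn1 h.
    by rewrite in_setI => /andP[zS zL] zU; exists z.
  right; exists y => //; apply/subsetP => x; rewrite in_setD1 => /andP[xy xL].
  apply: contraT => xS.
  have : [set x; y] \subset L :\: S.
    by rewrite subUset !sub1set !in_setD xS xL yS (subsetP UL).
  move/subset_leq_card; rewrite cards2 xy => h2.
  by move: h h2 cLS; rewrite cL; clear; lia.
case=> [[US [z [zS zL zU]]]|[y yU yS]].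
  have : z |: U \subset S :&: L by rewrite subsetI !subUset !sub1set zS zL US UL.
  by move/subset_leq_card; rewrite cardsU1 zU cU addnC.
have : L :\ y \subset S :&: L by rewrite subsetI yS subD1set.
move/subset_leq_card; apply: leq_trans; rewrite -ltnS -(cards_D1 (subsetP UL y yU)) cL.
by rewrite addn2 addn1.
Qed.

Lemma FtildeE k t : 0 < t -> t < k -> k + 1 <= m ->
  Ftilde m k t = hm_msets k (initial m t) (initial m (k + 1)).
Proof.
move=> t0 tk km.
set L := initial m (k + 1); set U := initial m t.
have cL : #|L| = k + 1 by apply: card_initial.
have UL : U \subset L.
  by apply/subsetP => x; rewrite !inE => /leq_trans; apply; rewrite addn1 ltnW // ltnW.
have LU : itv m (t + 1) (k + 1) = L :\: U.
  by apply/setP => x; rewrite in_setD !inE addn1 ltnS -leqNgt.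
have cLy y : y \in U -> #|L :\ y| = k.
  by move=> yU; apply: succn_inj; rewrite -(cards_D1 (subsetP UL y yU)) cL addn1.
have sS S : supp (vec_of (mset_of_set S)) = S.
  by apply/setP => x; rewrite in_supp mu_vec_of mset_of_setE; case: (x \in S).
have wS S : wt (vec_of (mset_of_set S)) = #|S|.
  by rewrite /wt -sum_ind; apply: eq_bigr => x _; rewrite mu_vec_of mset_of_setE.
apply/fsetP => A; rewrite in_hm_msets in_hfam -size_wt in_fsetU.
have -> : (A \in [fset A0 in kmultisets m k | (mset_of_set (itv m 1 t) `<=` A0)%mset &&
     ((A0 `&` mset_of_set (itv m (t + 1) (k + 1)))%mset != mset0)]) =
   (size (A : {mset 'I_m}) == k) && ((U \subset supp (vec_of A)) && (supp (vec_of A) :&: (L :\: U) != set0)).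
  rewrite 2!inE /= in_kmultisets itv1E LU; congr (_ && (_ && _)).
    apply/msubsetP/subsetP => [h x xU|h x].
      by rewrite in_supp mu_vec_of; apply: leq_trans (h x); rewrite mset_of_setE xU.
    by rewrite mset_of_setE; case: (boolP (x \in U)) => // /h; rewrite in_supp mu_vec_of.
  congr negb; apply/eqP/eqP => [e|e].
    apply/setP => x; rewrite in_setI in_supp mu_vec_of in_set0.
    have /msetP/(_ x) := e; rewrite msetE2 mset0E mset_of_setE.
    by case: (x \in L :\: U); rewrite ?andbF // andbT; case: (A x).
  apply/msetP => x; rewrite msetE2 mset0E mset_of_setE.
  have /setP/(_ x) := e; rewrite in_setI in_supp mu_vec_of in_set0.
  by case: (x \in L :\: U); rewrite ?minn0 // andbT; case: (A x).
(* As [L :\ y] has exactly [k] points, a [k]-multiset whose support contains it is equal to it. *)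
have -> : (A \in [fset mset_of_set (itv m 1 (k + 1) :\ i) | i in itv m 1 t]) =
   (size (A : {mset 'I_m}) == k) && [exists y in U, L :\ y \subset supp (vec_of A)].
  rewrite !itv1E -/U -/L; apply/imfsetP/andP => [[y /= yU ->]|[/eqP sA /existsP[y /andP[yU yA]]]].
    rewrite size_wt wS cLy // eqxx; split=> //; apply/existsP; exists y.
    by rewrite yU sS subxx.
  exists y => //; apply: vec_of_inj.
  have le x : mu (vec_of (mset_of_set (L :\ y))) x <= mu (vec_of A) x.
    rewrite mu_vec_of mset_of_setE; case: (boolP (x \in _)) => // xL.
    by rewrite -in_supp (subsetP yA).
  apply: vecP => x; apply/eqP; rewrite eq_sym eqn_leq le /= leqNgt; apply/negP => lt.
  have : wt (vec_of (mset_of_set (L :\ y))) < wt (vec_of A).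
    rewrite /wt (bigD1 x) //= [ltnRHS](bigD1 x) //= -addSn leq_add //.
    by apply: leq_sum => z _; apply: le.
  by rewrite wS cLy // -size_wt sA ltnn.
by rewrite -andb_orr.
Qed.

End Transfer.

(** * The bound and the case of equality *)

Section Bound.
Variables (t k m : nat) (F : {fset {mset 'I_m}}).
Hypotheses (ht : 1 < t) (htk : t < k) (hm : t * (k - t) + 2 < m).
Hypothesis hF : {in F, forall A : {mset 'I_m}, size A = k}.
Hypothesis hint : t_intersecting t F.
Hypothesis hcap : size (mset_bigcap F) < t.

Let t0 : 0 < t := ltnW ht.
Let km : k + 1 < m := shape_bounds t0 htk hm.
Let tm : t + 2 <= m. Proof. by move: htk km; clear; lia. Qed.

Lemma initial_subset (i j : nat) : i <= j -> initial m i \subset initial m j.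
Proof. by move=> ij; apply/subsetP => x; rewrite !inE => /leq_trans; apply. Qed.

Lemma card_hm_msets l : t + 2 <= l -> l <= k + 1 ->
  #|` hm_msets k (initial m t) (initial m l)| = hm_size m t k l.
Proof.
move=> tl lk; have lm : l <= m := leq_trans lk (ltnW km).
rewrite -card_vecs vecs_hm_msets (@card_hfamE m t k) ?card_initial //.
- by apply: initial_subset; apply: leq_trans tl; rewrite leq_addr.
- by apply: leq_trans tm; rewrite leq_addr.
Qed.

Lemma card_F1 : #|` F1 m k t| = hm_size m t k (t + 2).
Proof. by rewrite F1E // card_hm_msets // addn2 addn1 ltnS. Qed.

Lemma card_F1_gt0 : 0 < #|` F1 m k t|.
Proof.
have tk2 : t + 2 <= k + 1 by rewrite addn2 addn1 ltnS.
have UL : initial m t \subset initial m (t + 2) by apply: initial_subset; rewrite leq_addr.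
have cU : #|initial m t| = t by rewrite card_initial // (leq_trans _ tm) // leq_addr.
have cL : #|initial m (t + 2)| = t + 2 by apply: card_initial.
rewrite -{1}cL in tk2; have tL : t + 2 <= #|initial m (t + 2)| by rewrite cL.
have [A AH _] := hfam_coreless UL cU t0 tL tk2 (Ordinal km).
rewrite F1E // -card_vecs vecs_hm_msets cardfs_gt0; apply/fset0Pn; by exists A.
Qed.

Lemma card_Ftilde : #|` Ftilde m k t| = hm_size m t k (k + 1).
Proof. by rewrite FtildeE ?(ltnW km) // card_hm_msets // addn2 addn1 ltnS. Qed.

Lemma hm_size_le l : t + 2 <= l <= k + 1 ->
  hm_size m t k l <= maxn (hm_size m t k (t + 2)) (hm_size m t k (k + 1)).
Proof.
case/andP; rewrite leq_eqVlt => /orP[/eqP <- _|tl]; first exact: leq_maxl.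
rewrite leq_eqVlt => /orP[/eqP ->|lk]; first exact: leq_maxr.
exact/ltnW/hm_size_interior.
Qed.

Lemma family_extremal :
  #|` F| <= maxn (hm_size m t k (t + 2)) (hm_size m t k (k + 1)) /\
  (#|` F| = maxn (hm_size m t k (t + 2)) (hm_size m t k (k + 1)) ->
   exists2 l, l = t + 2 \/ l = k + 1 &
     #|` F| = hm_size m t k l /\ isomorphic F (hm_msets k (initial m t) (initial m l))).
Proof.
set M := maxn _ _.
(* The empty family meets the hypotheses, its [mset_bigcap] being empty, but [vecs_fam] excludes it;
   it cannot attain the positive bound. *)
have [->|F0] := eqVneq F fset0.
  rewrite cardfs0; split=> // M0; have : 0 < M by rewrite leq_max -card_F1 card_F1_gt0.
  by rewrite -M0.
have fF := vecs_fam hF hint hcap F0; have [G mG] := exists_maxfam fF.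
have card_max (F' : {fset vec m}) : maxfam k t F' -> exists U L : {set 'I_m},
    [/\ U \subset L, #|U| = t, t + 2 <= #|L| <= k + 1, F' = hfam k U L &
       #|` F'| = hm_size m t k #|L|].
  move=> mF'; have [U [L [UL cU tLk FH]]] := maxfam_hfam ht htk hm mF'.
  by exists U, L; case/andP: (tLk) => tL Lk; split; rewrite // FH (card_hfamE UL cU t0 tL Lk).
have GM : #|` G| <= M.
  by have [U [L [_ _ tLk _ ->]]] := card_max G mG; apply: hm_size_le.
have FG : #|` F| <= #|` G| by rewrite -card_vecs; apply: mG.2.
split=> [|FM]; first exact: leq_trans GM.
have mF : maxfam k t (vecs F).
  split=> // F' fF'; rewrite card_vecs FM; apply: leq_trans GM; exact: mG.2.
have [U [L [UL cU /andP[tL Lk] FH]]] := card_max _ mF; rewrite card_vecs => cF.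
have Fe : F = hm_msets k U L by apply: vecs_inj; rewrite vecs_hm_msets.
exists #|L|.
  move: tL; rewrite leq_eqVlt => /orP[/eqP <-|tL]; [by left|right].
  apply/eqP; rewrite eqn_leq Lk leqNgt; apply/negP => Lk'.
  by have := hm_size_interior ht htk hm tL Lk'; rewrite -cF FM ltnn.
split=> //; rewrite {1}Fe; apply: hm_msets_isomorphic => //.
- by apply: initial_subset; apply: leq_trans tL; rewrite leq_addr.
- by rewrite card_initial // (leq_trans _ tm) // leq_addr.
- by rewrite card_initial // (leq_trans Lk) // ltnW.
Qed.

End Bound.

Local Open Scope fset_scope.
Local Open Scope mset_scope.
Local Open Scope nat_scope.

Theorem theorem4p9 (t k m : nat) (F : {fset {mset 'I_m}})
  (ht : 1 < t) (htk : t < k) (hm : 2 * k - t <= m)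
  (hF : {in F, forall A : {mset 'I_m}, size A = k})
  (hint : t_intersecting t F)
  (hcap : size (mset_bigcap F) < t) :
  (t * (k - t) + 2 < m -> k <= 2 * t + 1 ->
     #|` F| <= #|` F1 m k t| /\
     (#|` F| = #|` F1 m k t| <-> isomorphic F (F1 m k t)))
  /\
  (t * (k - t) + 2 < m -> 2 * t + 1 < k ->
     #|` F| <= maxn #|` F1 m k t| #|` Ftilde m k t| /\
     (#|` F| = maxn #|` F1 m k t| #|` Ftilde m k t| <->
        (#|` Ftilde m k t| <= #|` F1 m k t| /\ isomorphic F (F1 m k t)) \/
        (#|` F1 m k t| <= #|` Ftilde m k t| /\ isomorphic F (Ftilde m k t)))).
Proof.
split=> hm' kt; have [le eqc] := family_extremal ht htk hm' hF hint hcap;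
  have tm : t + 2 <= m by [have := shape_bounds (ltnW ht) htk hm'; move: htk; clear; lia];
  have km : k + 1 <= m by [apply/ltnW/(shape_bounds (ltnW ht) htk hm')].
  (* For [k = t + 1] the two values [t + 2] and [k + 1] coincide; for larger [k] the size of F_(1)
     is strictly larger. *)
  have small : maxn (hm_size m t k (t + 2)) (hm_size m t k (k + 1)) = hm_size m t k (t + 2)
      /\ (hm_size m t k (k + 1) = hm_size m t k (t + 2) -> k + 1 = t + 2).
    move: (htk); rewrite leq_eqVlt => /orP[/eqP tk|tk].
      by rewrite -tk addn1 addn2 maxnn.
    have lt := hm_size_small ht htk hm' _ kt; rewrite addn1 in lt.
    have {}lt := lt tk; split; first by apply/maxn_idPl/ltnW.
    by move=> e; rewrite e ltnn in lt.
  rewrite card_F1 //; rewrite small.1 in le eqc; split=> //; split=> [cF|/isomorphic_card ->].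
    have [l [->|->] [cl iso]] := eqc cF; rewrite F1E //.
    by rewrite -small.2 // -cl.
  exact: card_F1.
rewrite card_F1 // card_Ftilde //; split=> //; split=> [cF|].
  have [l [->|->] [cl iso]] := eqc cF; [left|right]; rewrite -cl cF.
    by rewrite leq_maxr F1E.
  by rewrite leq_maxl FtildeE // ltnW.
case=> -[le12 /isomorphic_card ->]; rewrite ?card_F1 ?card_Ftilde //.
  by apply/esym/maxn_idPl.
by apply/esym/maxn_idPr.
Qed.
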